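(* Suppose that $\mathsf H:\mathcal H\to\mathbb R$ is continuous. Let $\mathfrak J_{\mathrm{gen}}$ be a generating collection of partitions, and for each $j\in\mathfrak J_{\mathrm{gen}}$ let $f_j:\mathbb R_+\times\mathcal C^j\to\mathbb R$ be a viscosity subsolution (respectively, supersolution) of $\mathrm{HJ}(\mathcal H^j,\mathcal C^j,\mathsf H^j)$. If $f=\lim_{j\in\mathfrak J_{\mathrm{gen}}}f_j^\uparrow$ in the local uniform topology for some $f:\mathbb R_+\times\mathcal C\to\mathbb R$, then $f$ is a viscosity subsolution (respectively, supersolution) of $\mathrm{HJ}(\mathcal H,\mathcal C,\mathsf H)$.
   Context: $\mathbb R_+=[0,\infty)$. Fix an integer $D\ge1$. $\mathbb S^D$ is the space of real symmetric $D\times D$ matrices with inner product $a\cdot b=\mathrm{tr}(ab)$ and norm $|a|=\sqrt{a\cdot a}$; $\mathbb S^D_+$ is the cone of positive semidefinite matrices; $a\ge b$ means $a-b\in\mathbb S^D_+$. $\mathcal H=L^2([0,1);\mathbb S^D)$ (Lebesgue measure) with $\langle\iota,\kappa\rangle_{\mathcal H}=\int_0^1\iota(s)\cdot\kappa(s)\,ds$ and norm $|\cdot|_{\mathcal H}$. $\mathcal C\subset\mathcal H$ is the closed convex cone of (classes of) functions $\mu:[0,1)\to\mathbb S^D_+$ that are square-integrable, right-continuous with left limits, and increasing, i.e. $\mu(t)-\mu(s)\in\mathbb S^D_+$ for $t\ge s$. Partitions. A partition is a tuple $j=(t_1,\dots,t_n)$ with $0<t_1<\dots<t_n=1$; $|j|=n$,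 $t_0=0$. Partitions are ordered by inclusion of the underlying sets. A collection of partitions is directed if any two members are both included in a third member; it is generating if it is directed and the sigma-algebras $\mathcal F_j$ generated by the intervals $[t_{k-1},t_k)$, $1\le k\le|j|$, over all its members $j$, together generate the Borel sigma-algebra of $[0,1)$. For nets indexed by a directed collection, $\lim_jx_j=x$ means: for each neighborhood $\mathcal N$ of $x$ there is a member $j_{\mathcal N}$ with $x_j\in\mathcal N$ for all members $j\supset j_{\mathcal N}$. Local uniform topology: uniform convergence on every closed metric ball of finite radius. For a partition $j$: $\mathcal H^j=(\mathbb S^D)^{|j|}$ with $\langle x,y\rangle_{\mathcal H^j}=\sum_k(t_k-t_{k-1})x_k\cdot y_k$; $\mathcal C^j=\{x\in\mathcal H^j:0\le x_1\le\dots\le x_{|j|}\}$; $\mathrm p_j:\mathcal H\to\mathcal H^j$, $(\mathrm p_j\iota)_k=\frac1{t_k-t_{k-1}}\int_{t_{k-1}}^{t_k}\iota(s)ds$; $\mathrm l_j:\mathcal H^j\to\mathcal H$, $\mathrm l_jx=\sum_kx_k\mathbf 1_{[t_{k-1},t_k)}$; $\mathsf H^j=\mathsf H\circ\mathrm l_j$; for $g:\mathbb R_+\times\mathcal C^j\to\mathbb R$, $g^\uparrow(t,\mu)=g(t,\mathrm p_j\mu)$ on $\mathbb R_+\times\mathcal C$. Viscosity solutions. Let $\mathcal X$ be a separable Hilbert space, $\mathcal D\subset\mathcal X$, $\mathsf G:\mathcal X\to\mathbb R$ continuous. A function $\phi:(0,\infty)\times\mathcal D\to\mathbb R$ is smooth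 if at every $(t,x)$ there is a unique $(\partial_t\phi(t,x),\nabla\phi(t,x))\in\mathbb R\times\mathcal X$ with $\phi(s,y)-\phi(t,x)=\partial_t\phi(t,x)(s-t)+\langle\nabla\phi(t,x),y-x\rangle+o(|s-t|+|y-x|)$ as $(s,y)\to(t,x)$ in $(0,\infty)\times\mathcal D$, the error is in fact $O(|s-t|^2+|y-x|^2)$ at every point, and $(t,x)\mapsto(\partial_t\phi,\nabla\phi)$ is continuous. A continuous $f:\mathbb R_+\times\mathcal D\to\mathbb R$ is a viscosity subsolution (resp. supersolution) of $\mathrm{HJ}(\mathcal X,\mathcal D,\mathsf G)$ (the equation $\partial_tf-\mathsf G(\nabla f)=0$ on $\mathbb R_+\times\mathcal D$) if for every $(t,x)\in(0,\infty)\times\mathcal D$ and smooth $\phi$ such that $f-\phi$ has a local maximum (resp. minimum) at $(t,x)$ relative to $(0,\infty)\times\mathcal D$, $(\partial_t\phi-\mathsf G(\nabla\phi))(t,x)\le0$ (resp. $\ge0$). *)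

(* Defs.v *)
From HB Require Import structures.
From mathcomp Require Import all_boot all_order all_algebra.
From mathcomp Require Import generic_quotient ring_quotient.
From mathcomp Require Import all_classical all_reals all_analysis measurable_realfun.
From mathcomp Require Import ring lra.
Set Implicit Arguments.
Unset Strict Implicit.
Unset Printing Implicit Defensive.
Import Order.TTheory GRing.Theory Num.Theory.
Import numFieldNormedType.Exports.
Local Open Scope classical_set_scope.
Local Open Scope ring_scope.

HB.mixin Record NormedModule_isInnerProduct (R : realType) V
    & NormedModule R V := {
  inner : V -> V -> R ;
  innerC : forall x y, inner x y = inner y x ;
  innerDl : forall x y z, inner (x + y) z = inner x z + inner y z ;
  innerZl : forall a x y, inner (a *: x) y = a * inner x y ;
  norm_inner : forall x : V, `|x| = Num.sqrt (inner x x)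
}.

#[short(type=innerProductType)]
HB.structure Definition InnerProduct (R : realType) :=
  {V of NormedModule_isInnerProduct R V & NormedModule R V}.

HB.factory Record Lmodule_isInnerProduct (R : realType) V
    & GRing.Lmodule R V := {
  inner : V -> V -> R ;
  innerC : forall x y, inner x y = inner y x ;
  innerDl : forall x y z, inner (x + y) z = inner x z + inner y z ;
  innerZl : forall a x y, inner (a *: x) y = a * inner x y ;
  inner_ge0 : forall x, 0 <= inner x x ;
  inner_eq0 : forall x, inner x x = 0 -> x = 0
}.

HB.builders Context R V & Lmodule_isInnerProduct R V.

Let n (x : V) : R := Num.sqrt (inner x x).

Let innerDr x y z : inner x (y + z) = inner x y + inner x z.
Proof. by rewrite innerC innerDl !(innerC x). Qed.

Let innerZr a x y : inner x (a *: y) = a * inner x y.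
Proof. by rewrite innerC innerZl (innerC x). Qed.

Let sqr_n x : n x ^+ 2 = inner x x.
Proof. by rewrite sqr_sqrtr// inner_ge0. Qed.

Let n_ge0 x : 0 <= n x. Proof. exact: sqrtr_ge0. Qed.

Let cauchy_schwarz x y : inner x y <= n x * n y.
Proof.
have [nx|nx0] := eqVneq (n x) 0.
  have -> : x = 0 by apply: inner_eq0; rewrite -sqr_n nx expr0n.
  by rewrite -[0](scale0r 0) innerZl mul0r mulr_ge0.
have [ny|ny0] := eqVneq (n y) 0.
  have -> : y = 0 by apply: inner_eq0; rewrite -sqr_n ny expr0n.
  by rewrite -[0](scale0r 0) innerZr mul0r mulr_ge0.
have h := inner_ge0 (n y *: x + (- n x) *: y).
rewrite innerDl !innerDr !innerZl !innerZr (innerC y x) -!sqr_n in h.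
have pxy : 0 < n x * n y by rewrite mulr_gt0// lt_neqAle eq_sym n_ge0 andbT.
have h2 : 0 <= (n x * n y) * (n x * n y - inner x y) by nra.
by rewrite pmulr_rge0// subr_ge0 in h2.
Qed.

Let n_triangle x y : n (x + y) <= n x + n y.
Proof.
rewrite -(@ler_pXn2r _ 2)// ?nnegrE ?addr_ge0//.
rewrite sqr_n innerDl !innerDr -!sqr_n (innerC y x).
by have := cauchy_schwarz x y; lra.
Qed.

Let nZ (a : R) x : n (a *: x) = `|a| * n x.
Proof.
by rewrite /n innerZl innerZr mulrA -expr2 sqrtrM ?sqr_ge0// sqrtr_sqr.
Qed.

Let n_eq0 x : n x = 0 -> x = 0.
Proof. by move=> nx; apply: inner_eq0; rewrite -sqr_n nx expr0n. Qed.

HB.instance Definition _ := Lmodule_isNormed.Build R V n_triangle nZ n_eq0.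
HB.instance Definition _ :=
  NormedModule_isInnerProduct.Build R V innerC innerDl innerZl (fun=> erefl).

HB.end.

Section InnerProductTheory.
Context (R : realType) (V : innerProductType R).
Implicit Types x : V.

Lemma innerDr x y z : inner x (y + z) = inner x y + inner x z.
Proof. by rewrite innerC innerDl !(innerC x). Qed.

Lemma innerZr a x y : inner x (a *: y) = a * inner x y.
Proof. by rewrite innerC innerZl (innerC x). Qed.

Lemma inner_ge0 x : 0 <= inner x x.
Proof.
rewrite leNgt; apply/negP => h.
have /eqP := norm_inner x; rewrite ltr0_sqrtr// normr_eq0 => /eqP x0.
by move: h; rewrite x0 -(scale0r 0) innerZl mul0r ltxx.
Qed.

Lemma sqr_norm_inner x : `|x| ^+ 2 = inner x x.
Proof. by rewrite norm_inner sqr_sqrtr// inner_ge0. Qed.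

End InnerProductTheory.

Section SymmetricMatrices.
Context (R : realType) (D : nat).

Definition sym_pred : {pred 'M[R]_D} := fun a => a^T == a.

Lemma sym_submod_closed : submod_closed sym_pred.
Proof.
split=> [|c a b]; rewrite !unfold_in; first by rewrite trmx0.
by move=> /eqP ha /eqP hb; rewrite linearD linearZ /= ha hb.
Qed.
HB.instance Definition _ :=
  GRing.isSubmodClosed.Build R 'M[R]_D sym_pred sym_submod_closed.

Record symmx := Symmx {symmx_val :> 'M[R]_D ; _ : symmx_val \in sym_pred}.
HB.instance Definition _ := [isSub for symmx_val].
HB.instance Definition _ := [Choice of symmx by <:].
HB.instance Definition _ := [SubChoice_isSubLmodule of symmx by <:].

Lemma symmxE (a : symmx) i j : a i j = a j i.
Proof. by case: a => a /= /eqP {1}<-; rewrite mxE. Qed.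

Lemma symmxD (a b : symmx) : symmx_val (a + b) = symmx_val a + symmx_val b.
Proof. by []. Qed.

Lemma symmxZ k (a : symmx) : symmx_val (k *: a) = k *: symmx_val a.
Proof. by []. Qed.

Definition symmx_dot (a b : symmx) : R := \tr (symmx_val a *m symmx_val b).

Lemma symmx_dotE a b : symmx_dot a b = \sum_i \sum_j a i j * b i j.
Proof.
rewrite /symmx_dot /mxtrace; apply: eq_bigr => i _.
by rewrite mxE; apply: eq_bigr => j _; rewrite (symmxE b).
Qed.

Let dotC a b : symmx_dot a b = symmx_dot b a.
Proof. exact: mxtrace_mulC. Qed.

Let dotDl a b c : symmx_dot (a + b) c = symmx_dot a c + symmx_dot b c.
Proof. by rewrite /symmx_dot symmxD mulmxDl linearD. Qed.

Let dotZl k a b : symmx_dot (k *: a) b = k * symmx_dot a b.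
Proof. by rewrite /symmx_dot symmxZ -scalemxAl linearZ. Qed.

Let dot_ge0 a : 0 <= symmx_dot a a.
Proof.
by rewrite symmx_dotE; do 2!apply: sumr_ge0 => ? _; rewrite -expr2 sqr_ge0.
Qed.

Let dot_eq0 a : symmx_dot a a = 0 -> a = 0.
Proof.
rewrite symmx_dotE => /eqP; rewrite psumr_eq0; last first.
  by move=> i _; apply: sumr_ge0 => j _; rewrite -expr2 sqr_ge0.
move=> /allP h; apply/val_inj/matrixP => i j; rewrite [RHS]mxE.
have /= := h i (mem_index_enum i).
rewrite psumr_eq0; last by move=> k _; rewrite -expr2 sqr_ge0.
by move=> /allP/(_ j (mem_index_enum j)); rewrite /= mulf_eq0 orbb => /eqP.
Qed.

HB.instance Definition _ :=
  Lmodule_isInnerProduct.Build R symmx dotC dotDl dotZl dot_ge0 dot_eq0.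

Lemma symmx_innerE (a b : symmx) : inner a b = \sum_i \sum_j a i j * b i j.
Proof. exact: symmx_dotE. Qed.

Definition psd (a : symmx) : Prop :=
  forall v : 'cV[R]_D, 0 <= (v^T *m symmx_val a *m v) 0 0.

End SymmetricMatrices.

(* The Hilbert space of square-integrable maps from [0, 1) to symmetric
   matrices.  Such a map is represented by a total function on R, of which only
   the restriction to [0, 1) matters: functions that agree almost everywhere on
   [0, 1) are identified in the quotient L2. *)

Section L2.
Context (R : realType) (D : nat).
Notation SD := (symmx R D).
Notation mu := (@lebesgue_measure R).
Notation I := (`[0, 1[%classic : set R).

Definition sqint (f : R -> SD) : Prop :=
  (forall i j, measurable_fun I (fun s => f s i j)) /\
  (\int[mu]_(s in I) (`|f s| ^+ 2)%:E < +oo)%E.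

Definition sqint_pred : {pred R -> SD} := fun f => `[< sqint f >].


Lemma measurable_inner (f g : R -> SD) :
  (forall i j, measurable_fun I (fun s => f s i j)) ->
  (forall i j, measurable_fun I (fun s => g s i j)) ->
  measurable_fun I (fun s => inner (f s) (g s)).
Proof.
move=> mf mg.
rewrite (_ : (fun s => _) = (fun s => \sum_i \sum_j f s i j * g s i j)).
  by do 2 (apply: measurable_sum => ?); exact: measurable_funM.
by apply/funext => s; rewrite symmx_innerE.
Qed.

Let le_inner (x y : SD) : `|inner x y| <= inner x x + inner y y.
Proof.
have h1 := inner_ge0 (x + y); have h2 := inner_ge0 (x + (-1) *: y).
rewrite !innerDl !innerDr !innerZl !innerZr (innerC y x) in h1 h2.
have := inner_ge0 x; have := inner_ge0 y.
by rewrite ler_norml; lra.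
Qed.

Lemma integrable_inner (f g : R -> SD) : sqint f -> sqint g ->
  mu.-integrable I (fun s => (inner (f s) (g s))%:E).
Proof.
have sqr h : sqint h -> mu.-integrable I (fun s => (inner (h s) (h s))%:E).
  move=> [mh ih]; apply/integrableP; split.
    by apply/measurable_EFinP; exact: measurable_inner.
  apply: le_lt_trans ih; rewrite le_eqVlt; apply/orP; left; apply/eqP.
  apply: eq_integral => s _ /=.
  by rewrite ger0_norm ?inner_ge0// sqr_norm_inner.
move=> hf hg; apply: (le_integrable _ _ _ (integrableD _ (sqr f hf) (sqr g hg))) => //.
  apply/measurable_EFinP; apply: measurable_inner; [exact: hf.1|exact: hg.1].
move=> s _ /=; rewrite lee_fin [leRHS]ger0_norm; first exact: le_inner.
by rewrite addr_ge0// inner_ge0.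
Qed.

Lemma sqint_submod_closed : submod_closed sqint_pred.
Proof.
split=> [|c f g].
  apply/asboolP; split=> [i j|].
    have -> : (fun s => (0 : R -> SD) s i j) = cst 0.
      by apply/funext => s; rewrite /= mxE.
    exact: measurable_cst.
  by under eq_integral do rewrite normr0 expr0n; rewrite integral0.
move=> /asboolP hf /asboolP hg; apply/asboolP; split=> [i j|].
  have -> : (fun s => (c *: f + g) s i j) = (fun s => c * f s i j + g s i j).
    by apply/funext => s; rewrite !mxE.
  apply: measurable_funD; last exact: hg.1.
  by apply: measurable_funM => //; exact: hf.1.
apply: (@le_lt_trans _ _
  (\int[mu]_(s in I) (`|(c ^+ 2 * inner (f s) (f s))%:E +
     (2 * c * inner (f s) (g s))%:E + (inner (g s) (g s))%:E|))%E).
  rewrite le_eqVlt; apply/orP; left; apply/eqP; apply: eq_integral => s _.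
  rewrite -!EFinD /= sqr_norm_inner; congr EFin.
  have -> : c ^+ 2 * inner (f s) (f s) + 2 * c * inner (f s) (g s) +
     inner (g s) (g s) = inner (c *: f s + g s) (c *: f s + g s).
    rewrite !innerDl !innerDr !innerZl !innerZr (innerC (g s) (f s)).
    by ring.
  by rewrite ger0_norm ?inner_ge0.
have mI : measurable (I : set (measurableTypeR R)) by [].
have h1 := integrableZl mI (c ^+ 2) (integrable_inner hf hf).
have h2 := integrableZl mI (2 * c) (integrable_inner hf hg).
have h3 := integrable_inner hg hg.
by have /integrableP[_] := integrableD mI (integrableD mI h1 h2) h3.
Qed.
HB.instance Definition _ :=
  GRing.isSubmodClosed.Build R (R -> SD) sqint_pred sqint_submod_closed.

Record sqfun := Sqfun {sqfun_val :> R -> SD ; _ : sqfun_val \in sqint_pred}.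
HB.instance Definition _ := [isSub for sqfun_val].
HB.instance Definition _ := [Choice of sqfun by <:].
HB.instance Definition _ := [SubChoice_isSubLmodule of sqfun by <:].

Lemma sqfunP (f : sqfun) : sqint f.
Proof. by case: f => f /= /asboolP. Qed.

Lemma sqfun_inner (f g : sqfun) :
  measurable_fun I (fun s => inner (f s) (g s)).
Proof.
by have [mf _] := sqfunP f; have [mg _] := sqfunP g; exact: measurable_inner.
Qed.

Definition null_pred : {pred sqfun} :=
  fun f => `[< \forall s \ae mu, I s -> f s = 0 >].

Lemma null_submod_closed : submod_closed null_pred.
Proof.
split=> [|c f g]; first by apply/asboolP; exact: aeW.
move=> /asboolP hf /asboolP hg; apply/asboolP.
have F : Filter (almost_everywhere mu) by exact: ae_filter_ringOfSetsType.
apply: (@filterS2 _ _ F _ _ _ _ hf hg) => s {}hf {}hg sI.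
by rewrite -[LHS]/(c *: f s + g s) hf// hg// scaler0 addr0.
Qed.
HB.instance Definition _ :=
  GRing.isSubmodClosed.Build R sqfun null_pred null_submod_closed.

Definition L2 : Type := {ideal_quot null_pred}.
HB.instance Definition _ := GRing.Zmodule.on L2.
HB.instance Definition _ := Quotient.on L2.

Local Open Scope quotient_scope.

Definition L2class (f : sqfun) : L2 := \pi_L2 f.

Lemma classP (f g : sqfun) :
  L2class f = L2class g <-> \forall s \ae mu, I s -> f s = g s.
Proof.
have -> : (L2class f = L2class g) <-> (f - g \in null_pred).
  by rewrite Quotient.idealrBE; split=> [/eqP|/eqP].
have E s : ((f - g : sqfun) s = 0) = (f s = g s).
  rewrite -[(f - g : sqfun) s]/(f s - g s).
  by apply/propext; split=> [/subr0_eq//|->]; rewrite subrr.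
split=> [/asboolP|] h; last apply/asboolP.
all: have F : Filter (almost_everywhere mu) by exact: ae_filter_ringOfSetsType.
all: by apply: (@filterS _ _ F _ _ _ h) => s + sI => /(_ sI); rewrite E.
Qed.

Lemma class_repr (x : L2) : L2class (repr x) = x. Proof. exact: reprK. Qed.

Lemma classD f g : L2class (f + g) = L2class f + L2class g.
Proof. by rewrite /L2class !piE. Qed.

Definition L2_scale (c : R) (x : L2) : L2 := L2class (c *: repr x).

Let pi_scale c f : L2class (c *: f) = L2_scale c (L2class f).
Proof.
apply/classP; have /classP h := esym (class_repr (L2class f)).
have F : Filter (almost_everywhere mu) by exact: ae_filter_ringOfSetsType.
apply: (@filterS _ _ F _ _ _ h) => s {}h sI.
by rewrite -[LHS]/(c *: f s) -[RHS]/(c *: repr (L2class f) s) (h sI).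
Qed.

Let scaleA a b x : L2_scale a (L2_scale b x) = L2_scale (a * b) x.
Proof. by rewrite -(class_repr x) -!pi_scale scalerA. Qed.
Let scale1 : left_id 1 L2_scale.
Proof. by move=> x; rewrite -(class_repr x) -pi_scale scale1r. Qed.
Let scaleDr : right_distributive L2_scale +%R.
Proof.
move=> a x y; rewrite -(class_repr x) -(class_repr y).
by rewrite -classD -!pi_scale -classD scalerDr.
Qed.
Let scaleDl x : {morph L2_scale^~ x : a b / a + b}.
Proof.
by move=> a b; rewrite -(class_repr x) -!pi_scale -classD scalerDl.
Qed.
HB.instance Definition _ :=
  GRing.Zmodule_isLmodule.Build R L2 scaleA scale1 scaleDr scaleDl.

Lemma classZ (c : R) f : L2class (c *: f) = c *: L2class f.
Proof. exact: pi_scale. Qed.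

Definition L2_inner (x y : L2) : R :=
  \int[mu]_(s in I) inner (repr x s) (repr y s).

Lemma class_inner f g :
  L2_inner (L2class f) (L2class g) = \int[mu]_(s in I) inner (f s) (g s).
Proof.
congr fine; apply: ae_eq_integral => //.
- by apply/measurable_EFinP; exact: sqfun_inner.
- by apply/measurable_EFinP; exact: sqfun_inner.
have /classP hf := class_repr (L2class f).
have /classP hg := class_repr (L2class g).
have F : Filter (almost_everywhere mu) by exact: ae_filter_ringOfSetsType.
by apply: (@filterS2 _ _ F _ _ _ _ hf hg) => s {}hf {}hg sI; rewrite hf ?hg.
Qed.

Let L2_innerC x y : L2_inner x y = L2_inner y x.
Proof. by congr fine; apply: eq_integral => s _; rewrite innerC. Qed.

Let L2_innerDl x y z : L2_inner (x + y) z = L2_inner x z + L2_inner y z.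
Proof.
rewrite -(class_repr x) -(class_repr y) -(class_repr z) -classD !class_inner.
rewrite -RintegralD //; [|by apply: integrable_inner; exact: sqfunP..].
by congr fine; apply: eq_integral => s _; rewrite -innerDl.
Qed.

Let L2_innerZl c x y : L2_inner (c *: x) y = c * L2_inner x y.
Proof.
rewrite -(class_repr x) -(class_repr y) -classZ !class_inner.
rewrite -RintegralZl //; last by apply: integrable_inner; exact: sqfunP.
by congr fine; apply: eq_integral => s _; rewrite -innerZl.
Qed.

Let L2_inner_ge0 x : 0 <= L2_inner x x.
Proof. by apply: Rintegral_ge0 => s _; exact: inner_ge0. Qed.

Let L2_inner_eq0 x : L2_inner x x = 0 -> x = 0.
Proof.
move=> h; rewrite -(class_repr x) (_ : 0 = L2class 0); last by rewrite /L2class !piE.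
have hx := sqfunP (repr x).
have mx := sqfun_inner (repr x) (repr x).
have fx := fineK (integrable_fin_num _ (integrable_inner hx hx)).
have : (\int[mu]_(s in I) `|(inner (repr x s) (repr x s))%:E| = 0)%E.
  transitivity (\int[mu]_(s in I) (inner (repr x s) (repr x s))%:E)%E.
    by apply: eq_integral => s _ /=; rewrite ger0_norm ?inner_ge0.
  by rewrite -fx //; congr EFin; exact: h.
move/(ae_eq_integral_abs _ _ _).1 => H; apply/classP.
have F : Filter (almost_everywhere mu) by exact: ae_filter_ringOfSetsType.
apply: (@filterS _ _ F _ _ _ (H _ _)) => //.
  move=> s + sI => /(_ sI) [] /eqP; rewrite -sqr_norm_inner sqrf_eq0 normr_eq0.
  by move=> /eqP.
by apply/measurable_EFinP.
Qed.

HB.instance Definition _ := Lmodule_isInnerProduct.Build R L2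
  L2_innerC L2_innerDl L2_innerZl L2_inner_ge0 L2_inner_eq0.


Lemma integral_symmx_subproof (A : set R) (f : R -> SD) :
  (\matrix_(i, j) \int[mu]_(s in A) f s i j : 'M[R]_D) \in @sym_pred R D.
Proof.
apply/eqP/matrixP => i j; rewrite !mxE.
by congr fine; apply: eq_integral => s _; rewrite symmxE.
Qed.

Definition integral_symmx (A : set R) (f : R -> SD) : SD :=
  Symmx (integral_symmx_subproof A f).

Definition cadlag (f : R -> SD) : Prop :=
  (forall t, 0 <= t < 1 -> f x @[x --> t^'+] --> f t) /\
  (forall t, 0 < t < 1 -> cvg (f x @[x --> t^'-])).

Definition loewner_increasing (f : R -> SD) : Prop :=
  forall s t, 0 <= s -> s <= t -> t < 1 -> psd (f t - f s).

Definition coneC : set L2 := [set h | exists f : sqfun,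
  [/\ h = L2class f, cadlag f, loewner_increasing f &
      forall t, 0 <= t < 1 -> psd (f t)]].

End L2.

Arguments coneC : clear implicits.

Section Partitions.
Context (R : realType).
Notation I := (`[0, 1[%classic : set R).

Record partition01 := Partition {
  points :> seq R ;
  _ : itv_partition 0 1 points }.

(* The subinterval of index k of j (counted from 0) is [tk j k, tk j k.+1),
   with tk j 0 = 0. *)
Definition tk (j : partition01) (k : nat) : R := nth 0 (0 :: points j) k.

Definition subpart (i j : partition01) : Prop :=
  {subset points i <= points j}.

Definition directed_partitions (J : set partition01) : Prop :=
  forall i j, J i -> J j ->
  exists k, [/\ J k, subpart i k & subpart j k].

Definition sigma_part (j : partition01) : set (set R) :=
  <<s I, [set A | exists2 k, (k < size j)%N &
                          A = `[tk j k, tk j k.+1[%classic] >>.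

Definition generating_partitions (J : set partition01) : Prop :=
  directed_partitions J /\
  <<s I, \bigcup_(j in J) sigma_part j >> =
  [set A | measurable A /\ A `<=` I].

(* The sections of the collection J, i.e. the filter along which nets indexed
   by J converge *)
Definition net_filter (J : set partition01) : set_system partition01 :=
  [set P | exists2 i, J i & forall j, J j -> subpart i j -> P j].

End Partitions.

Section StepSpace.
Context (R : realType) (D : nat) (j : partition01 R).
Notation SD := (symmx R D).
Notation mu := (@lebesgue_measure R).
Notation n := (size j).

Definition stepfun : Type := {ffun 'I_n -> SD}.
HB.instance Definition _ := GRing.Lmodule.on stepfun.

Definition width (k : 'I_n) : R := tk j k.+1 - tk j k.

Lemma width_gt0 k : 0 < width k.
Proof.
rewrite subr_gt0 /tk; case: j k => s /= [+ _] k; move/(pathP 0)/(_ k (ltn_ord k)).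
by [].
Qed.

Definition step_inner (x y : stepfun) : R := \sum_k width k * inner (x k) (y k).

Let step_innerC x y : step_inner x y = step_inner y x.
Proof. by apply: eq_bigr => k _; rewrite innerC. Qed.

Let step_innerDl x y z : step_inner (x + y) z = step_inner x z + step_inner y z.
Proof.
rewrite -big_split; apply: eq_bigr => k _.
by rewrite /= ffunE innerDl mulrDr.
Qed.

Let step_innerZl c x y : step_inner (c *: x) y = c * step_inner x y.
Proof.
rewrite /step_inner mulr_sumr; apply: eq_bigr => k _.
by rewrite ffunE innerZl mulrCA.
Qed.

Let step_inner_ge0 x : 0 <= step_inner x x.
Proof.
by apply: sumr_ge0 => k _; rewrite mulr_ge0 ?inner_ge0// ltW ?width_gt0.
Qed.

Let step_inner_eq0 x : step_inner x x = 0 -> x = 0.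
Proof.
move/eqP; rewrite psumr_eq0 => [/allP h|k _]; last first.
  by rewrite mulr_ge0 ?inner_ge0// ltW ?width_gt0.
apply/ffunP => k; rewrite [RHS]ffunE; have := h k (mem_index_enum k).
by rewrite /= mulf_eq0 gt_eqF ?width_gt0//= -sqr_norm_inner sqrf_eq0 normr_eq0
  => /eqP.
Qed.

HB.instance Definition _ := Lmodule_isInnerProduct.Build R stepfun
  step_innerC step_innerDl step_innerZl step_inner_ge0 step_inner_eq0.

Definition step_cone : set stepfun := [set x |
  (forall k, psd (x k)) /\
  (forall k l : 'I_n, (k <= l)%N -> psd (x l - x k))].

Definition step_proj (h : L2 R D) : stepfun :=
  [ffun k : 'I_n => (width k)^-1 *:
     integral_symmx `[tk j k, tk j k.+1[%classic (repr h)].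

Definition step_fun (x : stepfun) (s : R) : SD :=
  \sum_(k < n) (\1_(`[tk j k, tk j k.+1[%classic) s : R) *: x k.

Lemma step_fun_sqint x : step_fun x \in @sqint_pred R D.
Proof.
rewrite (_ : step_fun x = \sum_(k < n)
    (fun s => (\1_(`[tk j k, tk j k.+1[%classic) s : R) *: x k)); last first.
  by apply/funext => s; rewrite fct_sumE.
apply: rpred_sum => k _; apply/asboolP; split=> [i l|].
  rewrite (_ : (fun s => _) =
      (fun s => (\1_(`[tk j k, tk j k.+1[%classic) s : R) * x k i l)).
    by apply: measurable_funM => //; exact: measurable_funTS.
  by apply/funext => s; rewrite mxE.
apply: (@le_lt_trans _ _ (\int[mu]_(s in `[0%R, 1%R[%classic)
    (cst (`|x k| ^+ 2)%:E s))%E).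
  apply: ge0_le_integral => //=.
  - apply/measurable_EFinP.
    rewrite (_ : (fun s => _) = (fun s =>
        (\1_(`[tk j k, tk j k.+1[%classic) s : R) * `|x k| ^+ 2)).
      by apply: measurable_funM => //; exact: measurable_funTS.
    apply/funext => s; rewrite normrZ exprMn indicE.
    by case: (_ \in _); rewrite ?normr1 ?normr0 ?expr1n ?expr0n.
  - move=> s _; rewrite lee_fin normrZ exprMn indicE.
    by case: (_ \in _); rewrite ?normr1 ?normr0 ?expr1n ?expr0n /= ?mul1r
      ?mul0r ?sqr_ge0.
rewrite integral_cst //= lebesgue_measure_itv /= lte_fin ltr01.
by rewrite -EFinD -EFinM ltry.
Qed.

Definition step_lift (x : stepfun) : L2 R D := L2class (Sqfun (step_fun_sqint x)).

End StepSpace.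

Arguments step_cone {R} D j.

Section Viscosity.
Context (R : realType) (X : innerProductType R).
Implicit Types (dom : set X) (G : X -> R) (f phi : R * X -> R).

(* Functions on R_+ x dom, resp. (0, oo) x dom, are represented by functions on
   R * X whose values outside of that domain are irrelevant. *)
Definition time_dom dom : set (R * X) := [set z | 0 <= z.1 /\ dom z.2].
Definition otime_dom dom : set (R * X) := [set z | 0 < z.1 /\ dom z.2].

(* The pair d = (time derivative, gradient) *)
Definition taylor_error phi (z d w : R * X) : R :=
  phi w - phi z - (d.1 * (w.1 - z.1) + inner d.2 (w.2 - z.2)).

Definition is_diff_at dom phi (z d : R * X) : Prop :=
  forall e : R, 0 < e -> \forall w \near within (otime_dom dom) (nbhs z),
    `|taylor_error phi z d w| <= e * (`|w.1 - z.1| + `|w.2 - z.2|).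

(* phi is smooth, with time derivative and gradient given by dphi *)
Definition smooth dom phi (dphi : R * X -> R * X) : Prop :=
  [/\ forall z, otime_dom dom z ->
        is_diff_at dom phi z (dphi z) /\
        (forall d, is_diff_at dom phi z d -> d = dphi z),
      forall z, otime_dom dom z -> exists K : R,
        \forall w \near within (otime_dom dom) (nbhs z),
          `|taylor_error phi z (dphi z) w| <=
             K * (`|w.1 - z.1| ^+ 2 + `|w.2 - z.2| ^+ 2) &
      {within otime_dom dom, continuous dphi}].

Definition viscosity_subsolution dom G f : Prop :=
  {within time_dom dom, continuous f} /\
  forall phi dphi z, smooth dom phi dphi -> otime_dom dom z ->
    (\forall w \near within (otime_dom dom) (nbhs z),
       f w - phi w <= f z - phi z) ->
    (dphi z).1 - G (dphi z).2 <= 0.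

Definition viscosity_supersolution dom G f : Prop :=
  {within time_dom dom, continuous f} /\
  forall phi dphi z, smooth dom phi dphi -> otime_dom dom z ->
    (\forall w \near within (otime_dom dom) (nbhs z),
       f z - phi z <= f w - phi w) ->
    0 <= (dphi z).1 - G (dphi z).2.

(* The closed metric balls of R_+ x dom; {family closed_balls dom, _ -> _} is
   then the topology of local uniform convergence on R_+ x dom. *)
Definition closed_balls dom : set (set (R * X)) := [set B |
  exists z r, time_dom dom z /\ B = time_dom dom `&` [set w | `|w - z| <= r]].

End Viscosity.

Definition pullback (R : realType) (D : nat) (j : partition01 R)
    (g : R * stepfun D j -> R) : R * L2 R D -> R :=
  fun w => g (w.1, step_proj j w.2).

(* Main.v *)
(* A smooth test function phi touching f from above at z = (t, h) is pulled back
   along the isometry l_j and penalized by |s - t|^2 + |l_j x - h|^2.  Closed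
   bounded subsets of the finite-dimensional cone C^j are compact, so f_j minus
   this function attains its maximum over a ball around z.  A generating
   collection has dense partition points, hence l_j p_j is a family of orthogonal
   projections converging strongly to the identity; comparing the maximum with
   the value at (t, p_j h) forces the maximizers to converge to z.  They are thus
   eventually interior, and the equation satisfied by f_j at them passes to the
   limit.  Supersolutions for H are the negatives of subsolutions for
   p |-> - H (- p). *)
Require Import Defs.
From HB Require Import structures.
From mathcomp Require Import all_boot all_order all_algebra.
From mathcomp Require Import all_classical all_reals all_analysis.
From mathcomp Require Import measurable_realfun ring lra.
Set Implicit Arguments.
Unset Strict Implicit.
Unset Printing Implicit Defensive.
Import Order.TTheory GRing.Theory Num.Theory.
Import numFieldNormedType.Exports.
Local Open Scope classical_set_scope.
Local Open Scope ring_scope.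

(** * Inner products and positive semidefinite matrices *)

(** The operators [l_j p_j] converge to the identity strongly but not uniformly on bounded sets,
    while the equation for [f_j] yields a gradient at a maximizer that moves with [j]. So a small
    radius is fixed before [j], using continuity of the gradient of [phi] at [z]. Strong convergence
    is then needed at two fixed vectors only, [h] and the gradient of [phi] at [z], and the
    contraction property of [l_j p_j] extends it to nearby vectors. The Taylor remainder of the
    quadratic penalty is exactly the squared distance, so adding it keeps the quadratic error bound
    required of test functions. Smoothness also demands a unique differential relative to the cone,
    at its boundary points too; this holds because [C^j] is stable under sums and nonnegative
    multiples and spans [H^j]. *)

Section InnerProduct.
Context (R : realType) (V : innerProductType R).
Implicit Types x y z : V.

Lemma innerNl x y : inner (- x) y = - inner x y.
Proof. by rewrite -scaleN1r innerZl mulN1r. Qed.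

Lemma innerNr x y : inner x (- y) = - inner x y.
Proof. by rewrite innerC innerNl innerC. Qed.

Lemma innerBl x y z : inner (x - y) z = inner x z - inner y z.
Proof. by rewrite innerDl innerNl. Qed.

Lemma innerBr x y z : inner x (y - z) = inner x y - inner x z.
Proof. by rewrite innerDr innerNr. Qed.

Lemma inner0l y : inner 0 y = 0 :> R.
Proof. by rewrite -(scale0r 0) innerZl mul0r. Qed.

Lemma inner_suml I (r : seq I) (P : pred I) (F : I -> V) y :
  inner (\sum_(i <- r | P i) F i) y = \sum_(i <- r | P i) inner (F i) y.
Proof.
elim/big_rec2: _ => [|i a b _ <-]; first exact: inner0l.
by rewrite innerDl.
Qed.

Lemma inner_sumr I (r : seq I) (P : pred I) (F : I -> V) y :
  inner y (\sum_(i <- r | P i) F i) = \sum_(i <- r | P i) inner y (F i).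
Proof. by rewrite innerC inner_suml; apply: eq_bigr => i _; rewrite innerC. Qed.

Lemma cauchy_schwarz x y : `|inner x y| <= `|x| * `|y|.
Proof.
rewrite -(@ler_pXn2r _ 2)// ?nnegrE ?mulr_ge0// exprMn !sqr_norm_inner real_normK ?num_real//.
have [y0|y0] := eqVneq (inner y y) 0.
  have /eqP : `|y| ^+ 2 = 0 by rewrite sqr_norm_inner.
  by rewrite sqrf_eq0 normr_eq0 => /eqP ->; rewrite innerC inner0l expr0n mulr_ge0 // inner_ge0.
have yp : 0 < inner y y by rewrite lt_neqAle eq_sym y0 inner_ge0.
have := inner_ge0 (inner y y *: x - inner x y *: y).
rewrite innerBl !innerBr !innerZl !innerZr (innerC y x) => h.
have {}h : 0 <= inner y y * (inner x x * inner y y - inner x y ^+ 2) by nra.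
by rewrite pmulr_rge0 // subr_ge0 in h.
Qed.

Lemma inner_separated x y : (forall z, inner x z = inner y z) -> x = y.
Proof.
move=> h; apply/eqP; rewrite -subr_eq0 -normr_eq0 -sqrf_eq0 sqr_norm_inner.
by rewrite innerBl h subrr.
Qed.

Lemma inner_continuous y : continuous (fun x => inner x y).
Proof.
move=> x; apply/cvgrPdist_le => e e0.
near=> z; rewrite -innerBl (le_trans (cauchy_schwarz _ _))//.
rewrite (@le_trans _ _ (`|x - z| * (`|y| + 1)))//.
  by rewrite ler_wpM2l// lerDl.
rewrite -ler_pdivlMr ?ltr_wpDl//; near: z.
by apply: cvgr_dist_le; [exact: cvg_id|rewrite divr_gt0 ?ltr_wpDl].
Unshelve. all: by end_near. Qed.

End InnerProduct.

Section Psd.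
Context (R : realType) (D : nat).
Notation SD := (symmx R D).
Implicit Types a b : SD.

Lemma rank1_subproof (v : 'cV[R]_D) : v *m v^T \in @sym_pred R D.
Proof. by apply/eqP; rewrite trmx_mul trmxK. Qed.

Definition rank1 (v : 'cV[R]_D) : SD := Symmx (rank1_subproof v).

(** Positivity becomes a family of linear inequalities, so that sums, averages and closed conditions
    in the Loewner order reduce to scalar ones. *)
Lemma psdE a : psd a <-> forall v, 0 <= inner a (rank1 v).
Proof.
suff h v : (v^T *m symmx_val a *m v) 0 0 = inner a (rank1 v).
  by split=> p v; have := p v; rewrite h.
transitivity (\tr (symmx_val a *m (v *m v^T))).
  by rewrite -trace_mx11 -mulmxA mxtrace_mulC -mulmxA.
by [].
Qed.

Lemma psd0 : psd (0 : SD).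
Proof. by apply/psdE => v; rewrite inner0l. Qed.

Lemma psdD a b : psd a -> psd b -> psd (a + b).
Proof. by move=> /psdE ha /psdE hb; apply/psdE => v; rewrite innerDl addr_ge0. Qed.

Lemma psdZ (c : R) a : 0 <= c -> psd a -> psd (c *: a).
Proof. by move=> c0 /psdE ha; apply/psdE => v; rewrite innerZl mulr_ge0. Qed.

Lemma symmx1_subproof : (1%:M : 'M[R]_D) \in @sym_pred R D.
Proof. by apply/eqP; rewrite trmx1. Qed.

Definition symmx1 : SD := Symmx symmx1_subproof.

Lemma norm_rank1 v : `|rank1 v| = inner symmx1 (rank1 v).
Proof.
have e : inner symmx1 (rank1 v) = (v^T *m v) 0 0.
  transitivity (\tr (1%:M *m (v *m v^T))); first by [].
  by rewrite mul1mx mxtrace_mulC trace_mx11.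
have e0 : 0 <= (v^T *m v) 0 0.
  by rewrite mxE sumr_ge0// => i _; rewrite mxE -expr2 sqr_ge0.
rewrite norm_inner e; transitivity (Num.sqrt (((v^T *m v) 0 0) ^+ 2)).
  congr Num.sqrt; transitivity (\tr ((v *m v^T) *m (v *m v^T))); first by [].
  rewrite mulmxA -(mulmxA v) [v^T *m v]mx11_scalar mul_mx_scalar -scalemxAl.
  by rewrite mxtraceZ mxtrace_mulC trace_mx11 -expr2 [_%:M _ _]mxE eqxx mulr1n.
by rewrite sqrtr_sqr ger0_norm.
Qed.

(** By Cauchy-Schwarz, pairing [a] with [rank1 v] costs at most [c] times the norm of [rank1 v], and
    by [norm_rank1] this norm is the pairing of [rank1 v] with the identity. *)
Lemma psd_shift a (c : R) : `|a| <= c -> psd (a + c *: symmx1).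
Proof.
move=> h; apply/psdE => v; rewrite innerDl innerZl -norm_rank1.
have := le_trans (cauchy_schwarz a (rank1 v)) (ler_wpM2r (normr_ge0 (rank1 v)) h).
by rewrite ler_norml; lra.
Qed.

End Psd.

(** * Step functions attached to a partition *)

Section PartitionPoints.
Context (R : realType) (j : partition01 R).
Notation n := (size j).

Lemma tk0 : tk j 0 = 0. Proof. by []. Qed.

Lemma tk_size : tk j n = 1.
Proof.
rewrite /tk; case: j => s /= [_ /eqP <-].
by rewrite -[size s]/((size (0 :: s)).-1) nth_last.
Qed.

Lemma tk_ltS k : (k < n)%N -> tk j k < tk j k.+1.
Proof. by move=> kn; rewrite -subr_gt0; exact: (width_gt0 (Ordinal kn)). Qed.

Lemma tk_le k l : (k <= l)%N -> (l <= n)%N -> tk j k <= tk j l.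
Proof.
elim: l => [|l ih]; first by rewrite leqn0 => /eqP ->.
rewrite leq_eqVlt ltnS => /orP[/eqP -> //|kl ln].
by rewrite (le_trans (ih kl (ltnW ln)))// ltW// tk_ltS.
Qed.

Lemma tk_ge0 k : (k <= n)%N -> 0 <= tk j k.
Proof. by move=> kn; rewrite -tk0 tk_le. Qed.

Lemma tk_le1 k : (k <= n)%N -> tk j k <= 1.
Proof. by move=> kn; rewrite -tk_size tk_le. Qed.

Lemma tk_locate (s : R) : 0 <= s -> s < 1 ->
  exists k : 'I_n, tk j k <= s < tk j k.+1.
Proof.
move=> s0 s1.
have ex : exists k, (k < n)%N && (tk j k <= s).
  (* An empty list of points would identify [tk j 0 = 0] with [tk j (size j) = 1]. *)
  exists 0%N; rewrite tk0 s0 andbT lt0n; apply/negP => /eqP n0.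
  by have := tk_size; rewrite n0 tk0 => /eqP; rewrite eq_sym oner_eq0.
have ub k : (k < n)%N && (tk j k <= s) -> (k <= n)%N by move=> /andP[/ltnW].
case: (ex_maxnP ex ub) => k /andP[kn ks] mx; exists (Ordinal kn) => /=.
rewrite ks ltNge; apply/negP => h.
have [kn'|kn'] := boolP (k.+1 < n)%N.
  by have := mx k.+1; rewrite kn' h ltnn => /(_ isT).
have e : k.+1 = n by apply/eqP; rewrite eqn_leq kn leqNgt kn'.
by move: h; rewrite e tk_size leNgt s1.
Qed.

Lemma tk_itv_uniq (k l : 'I_n) (s : R) :
  tk j k <= s < tk j k.+1 -> tk j l <= s < tk j l.+1 -> k = l.
Proof.
move=> /andP[a b] /andP[c d]; apply/val_inj/eqP.
rewrite eqn_leq; apply/andP; split; rewrite leqNgt; apply/negP => h.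
  by have := tk_le h (ltnW (ltn_ord k)); lra.
by have := tk_le h (ltnW (ltn_ord l)); lra.
Qed.

Lemma sub_tk_itv (k : 'I_n) :
  `[tk j k, tk j k.+1[%classic `<=` (`[0, 1[%classic : set R).
Proof.
move=> s /=; rewrite !in_itv /= => /andP[a b].
by rewrite (le_trans (tk_ge0 (ltnW (ltn_ord k))) a) (lt_le_trans b)// tk_le1.
Qed.

End PartitionPoints.

(** * Integrals of real-valued and matrix-valued maps *)

Section Rintegral.
Context d (T : measurableType d) (R : realType).
Variable mu : {measure set T -> \bar R}.

Lemma Rintegral_sum (D : set T) (I : Type) (r : seq I) (F : I -> T -> R) :
  measurable D -> (forall i, mu.-integrable D (EFin \o F i)) ->
  \int[mu]_(x in D) (\sum_(i <- r) F i x) = \sum_(i <- r) \int[mu]_(x in D) F i x.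
Proof.
move=> mD iF; rewrite /Rintegral; under eq_integral do rewrite -sumEFin.
rewrite (integral_sum mD iF) -sum_fine // => i _.
exact: integrable_fin_num (iF i).
Qed.

Lemma Rintegral_indic (D A : set T) (f : T -> R) : A `<=` D ->
  \int[mu]_(x in D) (\1_A x * f x) = \int[mu]_(x in A) f x.
Proof.
move=> AD; rewrite /Rintegral -[in RHS](setIidr AD) [in RHS]integral_mkcondr.
congr fine; apply: eq_integral => x _.
by rewrite /restrict /= indicE; case: ifP => _; rewrite ?mul1r ?mul0r.
Qed.

End Rintegral.

Section SymmxIntegral.
Context (R : realType) (D : nat).
Notation SD := (symmx R D).
Notation mu := (@lebesgue_measure R).
Notation I := (`[0, 1[%classic : set R).

(** A real number is at most one plus its square; as [[0, 1)] has finite measure, the entries of a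
    square-integrable map are thus integrable. *)
Lemma symmx_entry_le (a : SD) i j : `|a i j| <= 1 + inner a a.
Proof.
have h : a i j ^+ 2 <= inner a a.
  rewrite symmx_innerE (bigD1 i)//= (bigD1 j)//= expr2 -addrA lerDl.
  by rewrite addr_ge0 ?sumr_ge0// => k _; rewrite ?sumr_ge0// => *; rewrite -expr2 sqr_ge0.
by rewrite ler_norml; apply/andP; split; nra.
Qed.

Lemma integrable_entry (f : R -> SD) (A : set R) i j :
  measurable (A : set (measurableTypeR R)) -> A `<=` I -> sqint f ->
  mu.-integrable A (fun s => (f s i j)%:E).
Proof.
move=> mA AI sf; apply: (integrableS _ mA AI) => //.
have i1 : mu.-integrable I (cst 1%:E).
  apply/integrableP; split; first exact: measurable_cst.
  by rewrite integral_cst //= lebesgue_measure_itv /= lte_fin ltr01 -EFinD normr1 -EFinM ltry.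
apply: (le_integrable _ _ _ (integrableD _ i1 (integrable_inner sf sf))) => //.
  by apply/measurable_EFinP; exact: sf.1.
by move=> s _ /=; rewrite lee_fin [leRHS]ger0_norm ?addr_ge0 ?inner_ge0// symmx_entry_le.
Qed.

Lemma integral_symmx_inner (A : set R) (f : R -> SD) (b : SD) :
  measurable (A : set (measurableTypeR R)) -> A `<=` I -> sqint f ->
  inner (integral_symmx A f) b = \int[mu]_(s in A) inner (f s) b.
Proof.
move=> mA AI sf; rewrite symmx_innerE.
have ie i j : mu.-integrable A (EFin \o (fun s => f s i j * b i j)).
  have := @integrableZr _ _ _ mu _ mA (b i j) _ (integrable_entry i j mA AI sf).
  by [].
have is_ i : mu.-integrable A (EFin \o (fun s => \sum_j f s i j * b i j)).
  have := @integrable_sum _ _ _ mu _ mA _ (index_enum 'I_D) xpredT _ (fun j _ => ie i j).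
  by apply: eq_integrable => // s _ /=; rewrite sumEFin.
under [RHS]eq_Rintegral do rewrite symmx_innerE.
rewrite (Rintegral_sum _ mA is_); apply: eq_bigr => i _.
rewrite (Rintegral_sum _ mA (ie i)); apply: eq_bigr => j _.
rewrite mxE -RintegralZr //; exact: integrable_entry.
Qed.

Lemma sqint_cst (b : SD) : sqint (fun _ : R => b).
Proof.
split=> [i j|]; first exact: measurable_cst.
by rewrite integral_cst //= lebesgue_measure_itv /= lte_fin ltr01 -EFinD -EFinM ltry.
Qed.

End SymmxIntegral.

(** * The isometric lift of step functions and its adjoint *)

Section StepMaps.
Context (R : realType) (D : nat) (j : partition01 R).
Notation SD := (symmx R D).
Notation mu := (@lebesgue_measure R).
Notation I := (`[0, 1[%classic : set R).
Notation n := (size j).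
Implicit Types (x y : stepfun D j) (v : L2 R D).

Lemma step_funE x (k : 'I_n) s : tk j k <= s < tk j k.+1 -> step_fun x s = x k.
Proof.
move=> ks; rewrite /step_fun (bigD1 k)//= big1 ?addr0 => [|l lk].
  by rewrite indicE mem_set ?scale1r//= in_itv.
rewrite indicE memNset ?scale0r//= in_itv /= => ls.
by move/negP: lk; apply; apply/eqP/(tk_itv_uniq ls ks).
Qed.

Lemma inner_step_lift v x :
  inner v (step_lift x) =
  \sum_(k < n) \int[mu]_(s in `[tk j k, tk j k.+1[) inner (repr v s) (x k).
Proof.
have hv := sqfunP (repr v).
rewrite -{1}(class_repr v) -[LHS]/(L2_inner _ _) /step_lift class_inner /=.
transitivity (\int[mu]_(s in I) \sum_(k < n)
    (\1_(`[tk j k, tk j k.+1[%classic) s * inner (repr v s) (x k))).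
  congr fine; apply: eq_integral => s _; congr EFin.
  by rewrite /step_fun inner_sumr; apply: eq_bigr => k _; rewrite innerZr.
rewrite Rintegral_sum // => [|k].
  by apply: eq_bigr => k _; rewrite Rintegral_indic//; exact: sub_tk_itv.
have ii := integrable_inner hv (@sqint_cst R D (x k)).
apply: (le_integrable _ _ _ ii) => //.
  apply/measurable_EFinP; apply: measurable_funM.
    exact: measurable_funTS.
  by have /integrableP[/measurable_EFinP] := ii.
move=> s _ /=; rewrite lee_fin normrM ler_piMl// indicE.
by case: (_ \in _); rewrite ?normr1 ?normr0.
Qed.

(** The weight [width k] of the inner product cancels the normalization of the average. Linearity,
    contraction and [step_projK] all follow by duality. *)
Lemma step_adjoint v x : inner (step_proj j v) x = inner v (step_lift x).
Proof.
rewrite inner_step_lift -[LHS]/(step_inner _ _); apply: eq_bigr => k _.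
rewrite ffunE innerZl mulrA mulfV ?gt_eqF ?width_gt0// mul1r.
by rewrite integral_symmx_inner//; [exact: sub_tk_itv|exact: sqfunP].
Qed.

(** [step_proj] integrates the representative picked by [repr]; this allows any other one, in
    particular the increasing map behind an element of [coneC]. *)
Lemma step_projE (f : sqfun R D) (k : 'I_n) b :
  inner (step_proj j (L2class f) k) b =
  (width k)^-1 * \int[mu]_(s in `[tk j k, tk j k.+1[) inner (f s) b.
Proof.
rewrite ffunE innerZl integral_symmx_inner//; [|exact: sub_tk_itv|exact: sqfunP].
congr (_ * fine _).
have ii (g : sqfun R D) : measurable_fun `[tk j k, tk j k.+1[%classic (fun s => inner (g s) b).
  have /integrableP[/measurable_EFinP m _] := integrable_inner (sqfunP g) (@sqint_cst R D b).
  by apply: measurable_funS m => //; exact: sub_tk_itv.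
apply: ae_eq_integral => //; [by apply/measurable_EFinP; exact: ii..|].
have /classP hf := class_repr (L2class f).
have F : Filter (almost_everywhere mu) by exact: ae_filter_ringOfSetsType.
apply: (@filterS _ _ F _ _ _ hf) => s h /sub_tk_itv sI.
by rewrite h.
Qed.

Lemma step_lift_inner x y : inner (step_lift x) (step_lift y) = inner x y.
Proof.
rewrite -step_adjoint; apply: eq_bigr => k _; rewrite step_projE/=.
rewrite mulrA mulfV ?gt_eqF ?width_gt0// mul1r.
rewrite (@eq_Rintegral _ _ _ mu _ (fun=> inner (x k) (y k))); last first.
  by move=> s /set_mem /=; rewrite in_itv /= => ks; rewrite (step_funE _ ks).
rewrite Rintegral_cst //= lebesgue_measure_itv /= lte_fin tk_ltS// -EFinD /=.
by rewrite mulrC.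
Qed.

Lemma step_liftD x y : step_lift (x + y) = step_lift x + step_lift y.
Proof.
rewrite /step_lift -classD; congr L2class; apply/val_inj/funext => s /=.
rewrite -[RHS]/(step_fun x s + step_fun y s) /step_fun -big_split/=.
by apply: eq_bigr => k _; rewrite ffunE scalerDr.
Qed.

Lemma step_liftZ c x : step_lift (c *: x) = c *: step_lift x.
Proof.
rewrite /step_lift -classZ; congr L2class; apply/val_inj/funext => s /=.
rewrite -[RHS]/(c *: step_fun x s) /step_fun scaler_sumr.
by apply: eq_bigr => k _; rewrite ffunE !scalerA mulrC.
Qed.

Lemma step_liftN x : step_lift (- x) = - step_lift x.
Proof. by rewrite -scaleN1r step_liftZ scaleN1r. Qed.

Lemma step_liftB x y : step_lift (x - y) = step_lift x - step_lift y.
Proof. by rewrite step_liftD step_liftN. Qed.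

Lemma step_projK x : step_proj j (step_lift x) = x.
Proof. by apply: inner_separated => y; rewrite step_adjoint step_lift_inner. Qed.

Lemma norm_step_lift x : `|step_lift x| = `|x|.
Proof. by rewrite !norm_inner step_lift_inner. Qed.

Lemma step_projD v w : step_proj j (v + w) = step_proj j v + step_proj j w.
Proof. by apply: inner_separated => y; rewrite innerDl !step_adjoint innerDl. Qed.

Lemma step_projN v : step_proj j (- v) = - step_proj j v.
Proof. by apply: inner_separated => y; rewrite innerNl !step_adjoint innerNl. Qed.

Lemma step_projB v w : step_proj j (v - w) = step_proj j v - step_proj j w.
Proof. by rewrite step_projD step_projN. Qed.

Lemma norm_step_proj v : `|step_proj j v| <= `|v|.
Proof.
have [->//|p0] := eqVneq (step_proj j v) 0; first by rewrite normr0.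
rewrite -(@ler_pM2r _ `|step_proj j v|) ?normr_gt0// -expr2 sqr_norm_inner.
rewrite step_adjoint (le_trans (ler_norm _))// (le_trans (cauchy_schwarz _ _))//.
by rewrite norm_step_lift.
Qed.

(** Subtracting the projection kills every lift, so [v] may be replaced by [v - step_lift x]; the
    factor 2 comes from the triangle inequality and contraction. *)
Lemma step_proj_dist_le v x :
  `|v - step_lift (step_proj j v)| <= 2 * `|v - step_lift x|.
Proof.
have -> : v - step_lift (step_proj j v) =
   (v - step_lift x) - step_lift (step_proj j (v - step_lift x)).
  by rewrite step_projB step_projK step_liftB opprB addrA subrK.
rewrite (le_trans (ler_normB _ _))// norm_step_lift.
by have := norm_step_proj (v - step_lift x); lra.
Qed.

End StepMaps.

(** * Monotone cones under lifting and averaging *)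

Section Cones.
Context (R : realType) (D : nat) (j : partition01 R).
Notation SD := (symmx R D).
Notation mu := (@lebesgue_measure R).
Notation I := (`[0, 1[%classic : set R).
Notation n := (size j).
Implicit Types (x y : stepfun D j).

(** At a partition point the left limit of a step function is its value on the interval that ends
    there, hence intervals closed on the right. *)
Lemma tk_locate_left (s : R) : 0 < s -> s <= 1 ->
  exists k : 'I_n, tk j k < s <= tk j k.+1.
Proof.
move=> s0 s1.
have ex : exists k, (k < n)%N && (tk j k < s).
  exists 0%N; rewrite tk0 s0 andbT lt0n; apply/negP => /eqP n0.
  by have := tk_size j; rewrite n0 tk0 => /eqP; rewrite eq_sym oner_eq0.
have ub k : (k < n)%N && (tk j k < s) -> (k <= n)%N by move=> /andP[/ltnW].
case: (ex_maxnP ex ub) => k /andP[kn ks] mx; exists (Ordinal kn) => /=.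
rewrite ks leNgt; apply/negP => h.
have [kn'|kn'] := boolP (k.+1 < n)%N.
  by have := mx k.+1; rewrite kn' h ltnn => /(_ isT).
have e : k.+1 = n by apply/eqP; rewrite eqn_leq kn leqNgt kn'.
by move: h; rewrite e tk_size ltNge s1.
Qed.

Lemma step_fun_cadlag x : cadlag (step_fun x).
Proof.
split=> t /andP[t0 t1].
  have [k /andP[k1 k2]] := tk_locate j t0 t1.
  rewrite (@step_funE _ _ _ x k t) ?k1//.
  apply: cvg_near_cst; near=> s; apply: step_funE.
  by rewrite (le_trans k1)//=.
have [k /andP[k1 k2]] := tk_locate_left t0 (ltW t1).
apply/cvg_ex; exists (x k); apply: cvg_near_cst; near=> s; apply: step_funE.
apply/andP; split; last by rewrite (lt_le_trans _ k2).
by apply/ltW.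
Unshelve. all: by end_near. Qed.

Lemma step_lift_cone x : step_cone D j x -> coneC R D (step_lift x).
Proof.
move=> [px mx]; exists (Sqfun (step_fun_sqint x)); split=> //.
- exact: step_fun_cadlag.
- move=> s t s0 st t1.
  have [k ks] := tk_locate j s0 (le_lt_trans st t1).
  have [l lt] := tk_locate j (le_trans s0 st) t1.
  rewrite /= (step_funE _ ks) (step_funE _ lt); apply: mx.
  rewrite leqNgt; apply/negP => lk.
  move: ks lt => /andP[ks _] /andP[_ lt].
  by have := tk_le lk (ltnW (ltn_ord k)); lra.
- move=> t /andP[t0 t1]; have [k kt] := tk_locate j t0 t1.
  by rewrite /= (step_funE _ kt).
Qed.

Lemma average_bounds (f : sqfun R D) (k : 'I_n) (b : SD) (c : R) :
  ((forall s, tk j k <= s < tk j k.+1 -> c <= inner (f s) b) ->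
     c <= inner (step_proj j (L2class f) k) b) /\
  ((forall s, tk j k <= s < tk j k.+1 -> inner (f s) b <= c) ->
     inner (step_proj j (L2class f) k) b <= c).
Proof.
have ib : mu.-integrable `[tk j k, tk j k.+1[%classic (EFin \o (fun s => inner (f s) b)).
  have := integrable_inner (sqfunP f) (@sqint_cst R D b).
  by apply: integrableS => //; exact: sub_tk_itv.
have ic : mu.-integrable `[tk j k, tk j k.+1[%classic (EFin \o (fun=> c)).
  apply: (@integrableS _ _ _ mu I) => //; first exact: sub_tk_itv.
  apply/integrableP; split; first exact: measurable_cst.
  by rewrite integral_cst //= lebesgue_measure_itv /= lte_fin ltr01 -EFinD -EFinM ltry.
(* Writing [c] as its own average turns both bounds into monotonicity of the integral. *)
have e : c = (width k)^-1 * \int[mu]_(s in `[tk j k, tk j k.+1[) c.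
  rewrite Rintegral_cst //= lebesgue_measure_itv /= lte_fin tk_ltS// -EFinD /=.
  by rewrite mulrC mulfK// gt_eqF ?width_gt0.
by rewrite step_projE {2 4}e !ler_pM2l ?invr_gt0 ?width_gt0//; split=> h;
  apply: le_Rintegral => // s /=; rewrite in_itv /=; exact: h.
Qed.

Lemma step_proj_cone h : coneC R D h -> step_cone D j (step_proj j h).
Proof.
move=> [f [-> _ mf pf]]; split=> [k|k l kl].
  apply/psdE => v; apply: (average_bounds _ _ _ _).1 => s /andP[ks sk].
  have := (psdE _).1 (pf s _); apply.
  by have := @sub_tk_itv _ j k s; rewrite /= !in_itv /= ks sk; apply.
have [->|kl'] := eqVneq k l; first by rewrite subrr; exact: psd0.
have {kl kl'} kl : (k < l)%N by rewrite ltn_neqAle kl andbT.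
have l1 : tk j l < 1 by rewrite (lt_le_trans (tk_ltS (ltn_ord l)))// tk_le1.
(* For [k < l] the value of [f] at the left end of interval [l] lies between the two averages. *)
apply/psdE => v; rewrite innerBl subr_ge0; apply: (@le_trans _ _ (inner (f (tk j l)) (rank1 v))).
  apply: (average_bounds _ _ _ _).2 => s /andP[ks sk].
  rewrite -subr_ge0 -innerBl; apply: (psdE _).1; apply: mf => //.
    by rewrite (le_trans _ ks)// tk_ge0// ltnW.
  by rewrite (le_trans (ltW sk))// tk_le// ltnW.
apply: (average_bounds _ _ _ _).1 => s /andP[ks sk].
rewrite -subr_ge0 -innerBl; apply: (psdE _).1; apply: mf => //.
  by rewrite tk_ge0// ltnW.
by rewrite (lt_le_trans sk)// tk_le1.
Qed.

(** A multiple of the identity growing linearly in [k] is in the cone, and stays there after adding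
    [z] if it is steep enough: the increment [c] dominates each [z k] and each difference
    [z l - z k] in norm. *)
Lemma step_cone_spans (z : stepfun D j) :
  exists x y, [/\ step_cone D j x, step_cone D j y & z = x - y].
Proof.
pose c := \sum_k `|z k| + \sum_k `|z k|.
have zc k : `|z k| <= \sum_k `|z k| by rewrite (bigD1 k)//= lerDl sumr_ge0.
pose y : stepfun D j := [ffun k : 'I_n => (c * k.+1%:R) *: symmx1 R D].
have c0 : 0 <= c by rewrite addr_ge0 ?sumr_ge0.
have p1 : psd (symmx1 R D).
  by apply/psdE => v; rewrite -norm_rank1.
exists (z + y), y; split; last by rewrite addrK.
- split=> [k|k l kl].
    rewrite !ffunE; apply: psd_shift; rewrite (le_trans (zc k))//.
    rewrite (@le_trans _ _ c)// ?lerDl ?sumr_ge0// ler_peMr// ler1n.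
  by [].
  have [->|kl'] := eqVneq k l; first by rewrite subrr; exact: psd0.
  have {kl kl'} kl : (k < l)%N by rewrite ltn_neqAle kl andbT.
  rewrite !ffunE opprD addrACA -scalerBl; apply: psd_shift.
  rewrite (le_trans (ler_normB _ _))// -mulrBr -natrB ?subSS; last by rewrite ltnS ltnW.
  apply: (@le_trans _ _ c); first by rewrite lerD.
  by rewrite ler_peMr// ler1n subn_gt0.
- split=> [k|k l kl]; first by rewrite ffunE; apply: psdZ => //; rewrite mulr_ge0.
  by rewrite !ffunE -scalerBl; apply: psdZ => //; rewrite -mulrBr mulr_ge0// subr_ge0 ler_nat.
Qed.

Lemma step_coneD x y : step_cone D j x -> step_cone D j y -> step_cone D j (x + y).
Proof.
move=> [px mx] [py my]; split=> [k|k l kl].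
  by rewrite ffunE; apply: psdD; [exact: px|exact: py].
rewrite [X in X - _]ffunE [X in _ - X]ffunE opprD addrACA.
by apply: psdD; [exact: mx|exact: my].
Qed.

Lemma step_coneZ c x : 0 <= c -> step_cone D j x -> step_cone D j (c *: x).
Proof.
move=> c0 [px mx]; split=> [k|k l kl]; first by rewrite ffunE; apply: psdZ.
rewrite [X in X - _]ffunE [X in _ - X]ffunE -scalerBr.
by apply: psdZ; [|exact: mx].
Qed.

Lemma coord_inner_continuous k (b : SD) : continuous (fun x => inner (x k) b).
Proof.
pose y : stepfun D j := [ffun l : 'I_n => if l == k then (width k)^-1 *: b else 0].
rewrite (_ : (fun x => _) = (fun x => inner x y)); first exact: inner_continuous.
apply/funext => x; rewrite -[RHS]/(step_inner x y) /step_inner (bigD1 k)//= big1 ?addr0.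
  by rewrite ffunE eqxx innerZr mulrA mulfV ?mul1r// gt_eqF ?width_gt0.
by move=> l lk; rewrite ffunE (negPf lk) innerC inner0l mulr0.
Qed.

Lemma closed_step_cone : closed (step_cone D j).
Proof.
have -> : step_cone D j =
   \bigcap_(v in [set: 'cV[R]_D])
     (\bigcap_(k in [set: 'I_n]) [set x | 0 <= inner (x k) (rank1 v)] `&`
      \bigcap_(p in [set p : 'I_n * 'I_n | (p.1 <= p.2)%N])
        [set x | 0 <= inner (x p.2) (rank1 v) - inner (x p.1) (rank1 v)]).
  apply/seteqP; split=> [x [px mx] v _|x hx].
    split=> [k _|[k l] /= kl]; first exact: ((psdE _).1 (px k)).
    by rewrite -innerBl; apply: ((psdE _).1 (mx k l kl)).
  split=> [k|k l kl]; apply/psdE => v; have [h1 h2] := hx v Logic.I.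
    exact: h1.
  by rewrite innerBl; exact: (h2 (k, l)).
apply: closed_bigI => v _; apply: closedI; apply: closed_bigI => k _.
  apply: (@closed_comp _ _ (fun x : stepfun D j => inner (x k) (rank1 v)) [set x | 0 <= x]).
    by move=> x _; exact: coord_inner_continuous.
  exact: closed_ge.
apply: (@closed_comp _ _ (fun x : stepfun D j => inner (x k.2) (rank1 v) - inner (x k.1) (rank1 v)) [set x | 0 <= x]).
  move=> x _; exact: (continuousB (@coord_inner_continuous k.2 (rank1 v) x) (@coord_inner_continuous k.1 (rank1 v) x)).
exact: closed_ge.
Qed.

End Cones.

(** * Convergence of the projections *)

Section Mesh.
Context (R : realType) (J : set (partition01 R)).
Hypothesis genJ : generating_partitions J.
Notation I01 := (`[0, 1[%classic : set R).

(* Otherwise every set generated by the partitions would contain or miss the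
   whole interval ]a, b[. *)
Lemma dense_points (a b : R) : 0 <= a -> a < b -> b <= 1 ->
  exists2 j, J j & exists2 p, p \in points j & a < p < b.
Proof.
move=> a0 ab b1; apply: contrapT => H.
have {}H j p : J j -> p \in points j -> ~ (a < p < b).
  by move=> Jj pj apb; apply: H; exists j => //; exists p.
have Ht j k : J j -> (k <= size j)%N -> tk j k <= a \/ b <= tk j k.
  (* The endpoint [tk j 0 = 0] is not taken from the list of points; it lies to the left of the
     interval because [0 <= a]. *)
  move=> Jj kn; case: k kn => [|k] kn; first by left; rewrite tk0.
  have := H j (tk j k.+1) Jj; rewrite /tk /= mem_nth// => /(_ isT) h.
  have [?|ap] := leP (nth 0 (points j) k) a; first by left.
  by right; rewrite leNgt; apply/negP => pb; apply: h; rewrite ap pb.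
pose ab_set := `]a, b[%classic : set R.
pose S := [set A : set R | ab_set `<=` A \/ ab_set `&` A = set0].
have abI : ab_set `<=` I01.
  move=> x; rewrite /ab_set /= !in_itv /= => /andP[ax xb].
  by rewrite (le_trans a0 (ltW ax)) (lt_le_trans xb).
have sS : sigma_algebra I01 S.
  split.
  - by right; rewrite setI0.
  - move=> A [hA|hA]; [right|left].
      by apply/seteqP; split=> // x [/hA Ax []].
    move=> x xab; split; first exact: abI.
    by move=> Ax; have : (ab_set `&` A) x by []; rewrite hA.
  - move=> F hF; have [[n hn]|hn] := pselect (exists n, ab_set `<=` F n).
      by left=> x /hn; exists n.
    right; rewrite setI_bigcupr; apply: bigcup0 => n _.
    by have [h|//] := hF n; case: hn; exists n.
(* The left half of []a, b[] is Borel, hence generated, yet it omits the midpoint of []a, b[] and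
   contains [a + (b - a) / 4], which contradicts both alternatives in [S]. *)
have : S (`]a, (a + b) / 2[%classic).
  have := genJ.2; rewrite eqEsubset => -[_ sub].
  have : <<s I01, \bigcup_(j in J) sigma_part j>> `<=` S.
    apply: smallest_sub => // A [j Jj]; apply: smallest_sub => //.
    move=> {}A [k kn ->].
    have [h1|h1] := Ht j k Jj (ltnW kn).
      have [h2|h2] := Ht j k.+1 Jj kn.
        right; apply/seteqP; split=> // x []; rewrite /ab_set /= !in_itv /=; lra.
      by left=> x; rewrite /ab_set /= !in_itv /=; lra.
    right; apply/seteqP; split=> // x []; rewrite /ab_set /= !in_itv /=; lra.
  apply; apply: sub; split => //.
  move=> x /=; rewrite !in_itv /=; lra.
move=> [h|h].
  have := h ((a + b) / 2); rewrite /ab_set /= !in_itv /=; lra.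
have : (ab_set `&` `]a, (a + b) / 2[%classic) (a + (b - a) / 4).
  rewrite /ab_set; split; rewrite /= in_itv /=; lra.
by rewrite h.
Qed.

(** Directedness gives stability under intersection; a first member of [J] comes from the density of
    partition points in []0, 1[]. *)
Lemma net_filter_proper : ProperFilter (net_filter J).
Proof.
have [i0 Ji0 _] := dense_points (lexx 0) ltr01 (lexx 1).
split; last split.
- by move=> [i Ji /(_ i Ji)]; apply => p.
- by exists i0.
- move=> P Q [i Ji hP] [k Jk hQ].
  have [l [Jl il kl]] := genJ.1 i k Ji Jk; exists l => // j Jj lj.
  split; [apply: hP => // p pi|apply: hQ => // p pk]; apply: lj; [exact: il|exact: kl].
- by move=> P Q PQ [i Ji hP]; exists i => // j Jj ij; apply: PQ; exact: hP.
Qed.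

Lemma near_member : \forall j \near net_filter J, J j.
Proof.
by have [i0 Ji0 _] := dense_points (lexx 0) ltr01 (lexx 1); exists i0.
Qed.

Lemma next_point (j : partition01 R) (k : 'I_(size j)) (p : R) :
  p \in points j -> tk j k < p -> tk j k.+1 <= p.
Proof.
move=> pj kp.
have pE : tk j (index p (points j)).+1 = p by rewrite /tk /= nth_index.
have ip : ((index p (points j)).+1 <= size j)%N by rewrite index_mem.
rewrite -pE in kp *; apply: tk_le => //; rewrite ltnNge; apply/negP => h.
by have := tk_le h (ltnW (ltn_ord k)); rewrite leNgt kp.
Qed.

(** Directedness yields one member with a point in each of [N.+1] cells of length [h]. In any
    refinement, an interval that starts in one cell ends before the end of the next, so its width is
    below [2 * h]. *)
Lemma mesh_small (e : R) : 0 < e ->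
  \forall j \near net_filter J, forall k : 'I_(size (points j)), width k < e.
Proof.
move=> e0; have [N Ne] : exists N : nat, 2 / N.+1%:R < e.
  exists (Num.truncn (2 / e)); rewrite ltr_pdivrMr// mulrC -ltr_pdivrMr//.
  exact: truncnS_gt.
pose h : R := N.+1%:R^-1.
have h0 : 0 < h by rewrite invr_gt0.
have hN : h * N.+1%:R = 1 by rewrite mulVf.
have fine_part m : (m <= N.+1)%N -> exists2 j0, J j0 & forall i, (i < m)%N ->
    exists2 p, p \in points j0 & h * i%:R < p < h * i.+1%:R.
  elim: m => [_|m ih mN]; first by have [i0 Ji0 _] := dense_points (lexx 0) ltr01 (lexx 1); exists i0.
  have [j0 J0 H0] := ih (ltnW mN).
  have [j1 J1 [p pj1 Hp]] : exists2 j, J j & exists2 p, p \in points j & h * m%:R < p < h * m.+1%:R.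
    apply: dense_points; first by rewrite mulr_ge0// ltW.
      by rewrite ltr_pM2l// ltr_nat.
    by rewrite -[leRHS]hN ler_pM2l// ler_nat.
  have [j2 [J2 s0 s1]] := genJ.1 j0 j1 J0 J1; exists j2 => // i.
  rewrite ltnS leq_eqVlt => /orP[/eqP ->|/H0[q qj Hq]].
    by exists p => //; exact: s1.
  by exists q => //; exact: s0.
have [j0 J0 H0] := fine_part N.+1 (leqnn _); exists j0 => // j Jj sj k.
have kn := ltn_ord k.
have s0 := tk_ge0 (ltnW kn); have s1 := tk_le1 kn.
pose i := Num.truncn (tk j k * N.+1%:R).
have /andP[i1 i2] : i%:R <= tk j k * N.+1%:R < i.+1%:R.
  by apply: truncn_itv; rewrite mulr_ge0.
have {}i1 : h * i%:R <= tk j k by rewrite mulrC ler_pdivrMr.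
have {}i2 : tk j k < h * i.+1%:R by rewrite mulrC ltr_pdivlMr.
have Ne' : 2 * h < e by [].
(* In the last cell there is no next one, but there the interval ends at 1 at the latest. *)
rewrite /width; have [iN|iN] := ltnP i.+1 N.+1.
  have [p pj0 /andP[p1 p2]] := H0 _ iN.
  have := @next_point j k p (sj _ pj0) (lt_trans i2 p1).
  by move: i1 p2; rewrite -!natr1 !mulrDr mulr1; lra.
have : h * N.+1%:R <= h * i.+1%:R by rewrite ler_pM2l// ler_nat.
by rewrite hN; move: i1; rewrite -!natr1 !mulrDr mulr1; lra.
Qed.

End Mesh.

(** * Density of continuous functions in the space of square-integrable ones *)

Section Density.
Context (R : realType).
Notation mu := (@lebesgue_measure R).
Notation I01 := (`[0, 1[%classic : set R).

Lemma uniform_continuity01 (g : R -> R) (e : R) : continuous g -> 0 < e ->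
  exists2 d, 0 < d & forall s t, 0 <= s <= 1 -> `|s - t| < d -> `|g s - g t| <= e.
Proof.
move=> cg e0.
have /compact_near_coveringP := @segment_compact R 0 1.
pose P (d s : R) := forall t, `|s - t| < d -> `|g s - g t| <= e.
move=> /(_ _ (0%R : R)^'+ P _) h.
have {}h : \forall d \near (0 : R)^'+, `[0, 1]%classic `<=` P d.
  apply: h => s _.
  have e2 : 0 < e / 2 by rewrite divr_gt0.
  have /cvgrPdist_le/(_ _ e2)/nbhs_ballP[r /= r0 hr] := cg s.
  have r2 : 0 < r / 2 by rewrite divr_gt0.
  (* Half radii, since [t] is compared with [s] through a point [s'] near [s]. *)
  exists (ball s (r / 2), [set d | d < r / 2]).
    split => /=; first exact: nbhsx_ballx.
    by near=> d; near: d; exact: nbhs_right_lt.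
  move=> [s' d] /= [ss' dr] t tt.
  have h1 : `|g s - g s'| <= e / 2.
    by apply: hr; apply: lt_le_trans ss' _; lra.
  have h2 : `|g s - g t| <= e / 2.
    apply: hr; rewrite /ball /= (_ : s - t = (s - s') + (s' - t)); last by ring.
    by have := ler_normD (s - s') (s' - t); have : `|s - s'| < r / 2 by []; lra.
  by move: h1 h2; rewrite !ler_norml; lra.
have [d [d0 hd]] : exists d, 0 < d /\ `[0, 1]%classic `<=` P d.
  near (0 : R)^'+ => d; exists d; split => //.
  by near: d; exact: h.
exists d => // s t s01; apply: hd; rewrite /= in_itv /=; exact: s01.
Unshelve. all: by end_near. Qed.

Definition clip (M x : R) := Num.max (- M) (Num.min M x).

Lemma clipE M x : 0 <= M ->
  clip M x = if M <= x then M else if x <= - M then - M else x.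
Proof.
move=> M0; rewrite /clip; case: (leP M x) => h; last by case: (leP x (- M)).
by apply/max_idPr; lra.
Qed.

Lemma clip_bound M x : 0 <= M -> `|clip M x| <= M.
Proof.
move=> M0; rewrite clipE// ler_norml.
by case: (leP M x) => ?; [|case: (leP x (- M)) => ?]; lra.
Qed.

Lemma clip_id M x : `|x| <= M -> clip M x = x.
Proof.
move=> xM; rewrite clipE ?(le_trans _ xM)//; move: xM; rewrite ler_norml.
by case: (leP M x) => ?; [|case: (leP x (- M)) => ?]; lra.
Qed.

Lemma clip_contract M x y : 0 <= M -> `|clip M x - clip M y| <= `|x - y|.
Proof.
move=> M0; have h1 := ler_norm (x - y).
have h2 := ler_norm (y - x); rewrite distrC in h2.
rewrite !clipE// ler_norml.
by case: (leP M x) => ?; [|case: (leP x (- M)) => ?];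
  (case: (leP M y) => ?; [|case: (leP y (- M)) => ?]); lra.
Qed.

Lemma clip_continuous M : continuous (clip M).
Proof.
move=> x; apply: (@continuous_max _ _ (fun=> - M) (fun y => Num.min M y)).
  exact: cst_continuous.
by apply: (@continuous_min _ _ (fun=> M) id); [exact: cst_continuous|].
Qed.

End Density.

Section Density.
Context (R : realType).
Notation mu := (@lebesgue_measure R).
Notation I01 := (`[0, 1[%classic : set R).

Lemma cvg0_small (u : (\bar R)^nat) (e : R) : u n @[n --> \oo] --> (0%:E)%E -> 0 < e ->
  exists n, (u n < e%:E)%E.
Proof.
move=> /fine_cvgP[fu cu] e0; near \oo => n; exists n.
rewrite -(fineK (near fu n _))// lte_fin.
suff : `|0 - (fine \o u) n| < e by rewrite sub0r normrN; apply: le_lt_trans; exact: ler_norm.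
by near: n; move/cvgrPdist_lt : cu; apply.
Unshelve. all: by end_near. Qed.

(** Approximation in [L^1] is upgraded to [L^2] by truncation: for functions bounded by [n] the
    squared difference is at most a constant times the difference. Truncating the continuous
    approximant as well keeps it continuous and does not increase its distance to the truncated
    [u]. *)
Lemma dense_continuous_L2 (u : R -> R) (e : R) :
  measurable_fun I01 u -> (\int[mu]_(s in I01) (u s ^+ 2)%:E < +oo)%E -> 0 < e ->
  exists2 g : R -> R, continuous g &
    (\int[mu]_(s in I01) ((u s - g s) ^+ 2)%:E < e%:E)%E.
Proof.
move=> mf iu e0.
have mI : measurable (I01 : set (measurableTypeR R)) by [].
have clip_meas M (h : R -> R) : measurable_fun I01 h -> measurable_fun I01 (fun s => clip M (h s)).
  move=> mh; apply: (measurableT_comp _ mh).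
  exact: continuous_measurable_fun (@clip_continuous R M).
have sq_meas (h k : R -> R) : measurable_fun I01 h -> measurable_fun I01 k ->
    measurable_fun I01 (fun s => ((h s - k s) ^+ 2)%:E).
  move=> mh mk; apply/measurable_EFinP; apply: measurable_funX.
  exact: measurable_funB.
have [n Hn] : exists n : nat,
    (\int[mu]_(s in I01) ((u s - clip n%:R (u s)) ^+ 2)%:E < (e / 4)%:E)%E.
  apply: cvg0_small; last by rewrite divr_gt0.
  have [] := @dominated_convergence _ _ R mu I01 mI
    (fun n s => ((u s - clip n%:R (u s)) ^+ 2)%:E) (fun=> 0%E) (fun s => (u s ^+ 2)%:E).
  - by move=> n; apply: sq_meas => //; exact: clip_meas.
  - exact: measurable_cst.
  - apply: aeW => s _; apply: cvg_near_cst.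
    exists (Num.truncn `|u s|).+1 => // n /= h; rewrite clip_id ?subrr ?expr0n//.
    by rewrite (le_trans (ltW (truncnS_gt _)))// ler_nat.
  - apply/integrableP; split; first by apply/measurable_EFinP; exact: measurable_funX.
    by apply: le_lt_trans iu; under eq_integral do rewrite abse_EFin ger0_norm ?sqr_ge0//.
  - apply: aeW => s n _; rewrite lee_fin ger0_norm ?sqr_ge0//.
    rewrite -[leLHS]real_normK ?num_real// -[leRHS]real_normK ?num_real//.
    rewrite ler_pXn2r ?nnegrE// clipE//.
    have := ler_norm (u s); have := ler_norm (- u s); rewrite normrN ler_norml.
    have : 0 <= n%:R :> R by [].
    by case: (leP n%:R (u s)) => ?; [|case: (leP (u s) (- n%:R)) => ?]; lra.
  by move=> _ _; rewrite integral0.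
have muI : (mu I01 < +oo)%E by rewrite lebesgue_measure_itv /= lte_fin ltr01 -EFinD ltry.
pose w s := clip n%:R (u s).
have mw : measurable_fun I01 w by exact: clip_meas.
have iw : mu.-integrable I01 (EFin \o w).
  apply: (@measurable_bounded_integrable _ _ R mu w I01 mI muI mw).
  exists n%:R; split; rewrite ?num_real// => x nx s _ /=.
  by rewrite (le_trans _ (ltW nx))// clip_bound.
have [g_ [cg ig gcv]] := approximation_continuous_integrable mI muI iw.
(* Below, this [L^1] error is multiplied by [4 * n.+1] and the truncation error [e / 4] by 2, so
   each contributes [e / 2]; the successor keeps the divisor nonzero. *)
have e8 : 0 < e / (8 * n.+1%:R) by rewrite divr_gt0// mulr_gt0.
have [k Hk] := cvg0_small gcv e8.
pose g s := clip n%:R (g_ k s).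
have cont_g : continuous g.
  move=> s; apply: (@continuous_comp _ _ _ (g_ k) (clip n%:R)); first exact: cg.
  exact: clip_continuous.
have mg : measurable_fun I01 g.
  by apply: measurable_funTS; exact: continuous_measurable_fun.
have mgk : measurable_fun I01 (g_ k).
  by apply: measurable_funTS; exact: continuous_measurable_fun.
exists g => //.
apply: (@le_lt_trans _ _ (\int[mu]_(s in I01) ((2 * (u s - w s) ^+ 2)%:E + (4 * n.+1%:R * `|w s - g_ k s|)%:E)))%E.
  apply: ge0_le_integral => //.
  - by move=> s _; rewrite lee_fin sqr_ge0.
  - exact: sq_meas.
  - apply: emeasurable_funD; apply/measurable_EFinP.
      apply: measurable_funM => //; apply/measurable_EFinP; exact: sq_meas.
    apply: measurable_funM => //; apply: measurableT_comp => //; exact: measurable_funB.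
  move=> s _; rewrite -EFinD lee_fin.
  have h1 : `|w s - g s| <= `|w s - g_ k s|.
    rewrite -{1}(@clip_id R n%:R (w s)) ?clip_bound//; exact: clip_contract.
  have h2 : `|w s - g s| <= 2 * n.+1%:R.
    rewrite (le_trans (ler_normB _ _))//.
    have a1 : `|w s| <= n%:R by exact: clip_bound.
    have a2 : `|g s| <= n%:R by exact: clip_bound.
    by rewrite -natr1; lra.
  have h3 : (w s - g s) ^+ 2 <= 2 * n.+1%:R * `|w s - g_ k s|.
    by rewrite -real_normK ?num_real// expr2 ler_pM.
  have := sqr_ge0 ((u s - w s) - (w s - g s)); nra.
have m1 : measurable_fun I01 (fun s => ((u s - w s) ^+ 2)%:E) by exact: sq_meas.
have m2 : measurable_fun I01 (fun s => `|w s - g_ k s|%:E).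
  by apply/measurable_EFinP; apply: measurableT_comp => //; exact: measurable_funB.
have p1 s : I01 s -> (0 <= ((u s - w s) ^+ 2)%:E)%E by rewrite lee_fin sqr_ge0.
have p2 s : I01 s -> (0 <= `|w s - g_ k s|%:E)%E by rewrite lee_fin.
have c1 : (0 <= 2%:E :> \bar R)%E by rewrite lee_fin.
have c2 : (0 <= (4 * n.+1%:R)%:E :> \bar R)%E by rewrite lee_fin mulr_ge0.
rewrite (_ : (fun s => _) = (fun s => 2%:E * ((u s - w s) ^+ 2)%:E +
  (4 * n.+1%:R)%:E * `|w s - g_ k s|%:E)%E); last by [].
have q1 s : I01 s -> (0 <= 2%:E * ((u s - w s) ^+ 2)%:E)%E by move=> Is; rewrite mule_ge0 ?p1.
have q2 s : I01 s -> (0 <= (4 * n.+1%:R)%:E * `|w s - g_ k s|%:E)%E.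
  by move=> Is; rewrite mule_ge0 ?p2.
have n1 := measurable_funeM 2%:E m1; have n2 := measurable_funeM (4 * n.+1%:R)%:E m2.
rewrite (ge0_integralD mu mI q1 n1 q2 n2).
rewrite (ge0_integralZl mu mI m1 p1 c1) (ge0_integralZl mu mI m2 p2 c2).
have A : (2%:E * \int[mu]_(s in I01) ((u s - w s) ^+ 2)%:E < (e / 2)%:E)%E.
  rewrite (_ : e / 2 = 2 * (e / 4)); last by field.
  by rewrite EFinM lte_pmul2l.
have B : ((4 * n.+1%:R)%:E * \int[mu]_(s in I01) `|w s - g_ k s|%:E < (e / 2)%:E)%E.
  rewrite (_ : e / 2 = (4 * n.+1%:R) * (e / (8 * n.+1%:R))); last by field.
  by rewrite [X in (_ < X)%E]EFinM lte_pmul2l// lte_fin mulr_gt0.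
by rewrite [X in (_ < X%:E)%E]splitr; exact: (lteD A B).
Qed.

End Density.

(** * Strong convergence of the projections *)

Section Projections.
Context (R : realType) (D : nat) (J : set (partition01 R)).
Hypothesis genJ : generating_partitions J.
Notation SD := (symmx R D).
Notation mu := (@lebesgue_measure R).
Notation I01 := (`[0, 1[%classic : set R).

Lemma continuous_L2_approx (f : sqfun R D) (c : R) : 0 < c ->
  exists G : R -> SD,
    (forall i j, continuous (fun s => G s i j)) /\
    (forall i j, (\int[mu]_(s in I01) ((f s i j - G s i j) ^+ 2)%:E < c%:E)%E).
Proof.
move=> c0; have [mf fi] := sqfunP f.
have approx i j : {g : R -> R | continuous g /\
    (\int[mu]_(s in I01) ((f s i j - g s) ^+ 2)%:E < c%:E)%E}.
  apply: cid; have [|g cg gi] := dense_continuous_L2 (mf i j) _ c0; last by exists g.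
  apply: le_lt_trans fi; apply: ge0_le_integral => //.
  - by move=> s _; rewrite lee_fin sqr_ge0.
  - by apply/measurable_EFinP; apply: measurable_funX; exact: mf.
  - apply/measurable_EFinP; rewrite (_ : (fun s => _) = (fun s => inner (f s) (f s))).
      exact: sqfun_inner.
    by apply/funext => s; rewrite sqr_norm_inner.
  move=> s _; rewrite lee_fin sqr_norm_inner symmx_innerE (bigD1 i)//= (bigD1 j)//=.
  rewrite expr2 -addrA lerDl addr_ge0// ?sumr_ge0// => *.
    by rewrite -expr2 sqr_ge0.
  by rewrite sumr_ge0// => *; rewrite -expr2 sqr_ge0.
pose g i j := sval (approx i j).
(* The entries were approximated independently, so symmetry is restored by reflecting the upper
   triangle. *)
have sym s : (\matrix_(i, j) (if (i <= j)%N then g i j s else g j i s) : 'M[R]_D) \in @sym_pred R D.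
  apply/eqP/matrixP => i j; rewrite !mxE; case: (ltngtP i j) => // ij.
  by rewrite (val_inj ij).
exists (fun s => Symmx (sym s)); split=> i j.
  rewrite (_ : (fun s => _) = if (i <= j)%N then g i j else g j i).
    by case: ifP => _; [exact: (svalP (approx i j)).1|exact: (svalP (approx j i)).1].
  by apply/funext => s; rewrite mxE; case: ifP.
have -> : (\int[mu]_(s in I01) ((f s i j - Symmx (sym s) i j) ^+ 2)%:E =
    \int[mu]_(s in I01)
      (if (i <= j)%N then (f s i j - g i j s) ^+ 2 else (f s j i - g j i s) ^+ 2)%:E)%E.
  apply: eq_integral => s _; rewrite mxE.
  by case: ifP => // _; rewrite (symmxE (f s)).
by case: (i <= j)%N; [exact: (svalP (approx i j)).2|exact: (svalP (approx j i)).2].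
Qed.

(** A continuous approximant is sampled at the left ends of the intervals; on a fine mesh its
    oscillation is small uniformly. *)
Lemma step_approx (v : L2 R D) (e : R) : 0 < e ->
  \forall j \near net_filter J, exists x : stepfun D j, `|v - step_lift x| <= e.
Proof.
move=> e0; have FF := net_filter_proper genJ.
pose f := repr v; have [mf _] := sqfunP f.
(* Each of the [D * D] entries contributes at most [2 * c ^+ 2] from the approximation and as much
   from the oscillation, in total at most [e ^+ 2]. *)
pose c := e / (2 * D.+1%:R).
have c0 : 0 < c by rewrite divr_gt0// mulr_gt0.
have c2 : 0 < c ^+ 2 by rewrite exprn_gt0.
have [G [cG Gi]] := continuous_L2_approx f c2.
have osc : \forall p \near net_filter J, forall i, forall j, forall k : 'I_(size (points p)),
    forall s, tk p k <= s < tk p k.+1 -> `|G (tk p k) i j - G s i j| <= c.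
  apply: filter_forall => i; apply: filter_forall => j.
  have [d d0 hd] := uniform_continuity01 (cG i j) c0.
  apply: filterS (mesh_small genJ d0) => p hp k s /andP[ks sk].
  apply: hd; first by rewrite tk_ge0 1?ltnW//= tk_le1 1?ltnW.
  rewrite distrC ger0_norm ?subr_ge0//; have := hp k; rewrite /width; lra.
apply: filterS osc => p hp.
pose x : stepfun D p := [ffun k : 'I_(size (points p)) => G (tk p k)]; exists x.
have mI : measurable (I01 : set (measurableTypeR R)) by [].
pose h : sqfun R D := f - Sqfun (step_fun_sqint x).
have vE : v - step_lift x = L2class h.
  by rewrite /h /step_lift -[v in LHS]class_repr -[- L2class _]scaleN1r -classZ -classD scaleN1r.
rewrite -(@ler_pXn2r _ 2)// ?nnegrE ?(ltW e0)// sqr_norm_inner vE -[leLHS]/(L2_inner _ _) class_inner.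
rewrite -lee_fin /Rintegral fineK; last first.
  by apply: integrable_fin_num => //; apply: integrable_inner; exact: sqfunP.
pose F i j s : R := 2 * (f s i j - G s i j) ^+ 2 + 2 * c ^+ 2.
have F0 i j s : 0 <= F i j s by rewrite addr_ge0// mulr_ge0// sqr_ge0.
have mG i j : measurable_fun I01 (fun s => G s i j).
  by apply: measurable_funTS; exact: continuous_measurable_fun.
have m1 i j : measurable_fun I01 (fun s => (f s i j - G s i j) ^+ 2).
  by apply: measurable_funX; exact: measurable_funB.
have mF i j : measurable_fun I01 (F i j).
  by apply: measurable_funD => //; exact: measurable_funM.
apply: (@le_trans _ _ (\int[mu]_(s in I01) (\sum_i \sum_j F i j s)%:E)%E).
  apply: ge0_le_integral => //.
  - by move=> s _; rewrite lee_fin inner_ge0.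
  - by apply/measurable_EFinP; exact: sqfun_inner.
  - by apply/measurable_EFinP; do 2 (apply: measurable_sum => ?); exact: mF.
  move=> s /=; rewrite in_itv /= => /andP[s0 s1].
  rewrite lee_fin symmx_innerE; apply: ler_sum => i _; apply: ler_sum => j _.
  have [k ks] := tk_locate p s0 s1.
  have -> : h s i j = f s i j - G (tk p k) i j.
    rewrite -[h s]/(f s - step_fun x s) (step_funE _ ks) ffunE.
    by rewrite !mxE.
  have := hp i j k s ks; rewrite ler_norml => /andP[a1 a2].
  have : (G (tk p k) i j - G s i j) ^+ 2 <= c ^+ 2 by nra.
  have := sqr_ge0 ((f s i j - G s i j) + (G (tk p k) i j - G s i j)).
  rewrite /F; nra.
have IF i j : (\int[mu]_(s in I01) (F i j s)%:E <= (4 * c ^+ 2)%:E)%E.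
  rewrite (_ : (fun s => _) = (fun s => 2%:E * ((f s i j - G s i j) ^+ 2)%:E + (2 * c ^+ 2)%:E)%E); last first.
    by apply/funext => s; rewrite /F EFinD EFinM.
  have m2 : measurable_fun I01 (fun s => ((f s i j - G s i j) ^+ 2)%:E) by apply/measurable_EFinP.
  have p2 s : I01 s -> (0 <= ((f s i j - G s i j) ^+ 2)%:E)%E by rewrite lee_fin sqr_ge0.
  have p3 s : I01 s -> (0 <= 2%:E * ((f s i j - G s i j) ^+ 2)%:E)%E.
    by move=> Is; rewrite mule_ge0 ?p2// lee_fin.
  have p4 s : I01 s -> (0 <= (2 * c ^+ 2)%:E)%E by rewrite lee_fin mulr_ge0// ltW.
  have t2 : (0 <= 2%:E :> \bar R)%E by rewrite lee_fin.
  rewrite (ge0_integralD mu mI p3 (measurable_funeM 2%:E m2) p4 (measurable_cst _)).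
  rewrite (ge0_integralZl mu mI m2 p2 t2) integral_cst//=.
  rewrite lebesgue_measure_itv /= lte_fin ltr01 -EFinD subr0 mule1.
  rewrite (_ : 4 * c ^+ 2 = 2 * c ^+ 2 + 2 * c ^+ 2); last by ring.
  rewrite [X in (_ <= X)%E]EFinD; apply: leeD => //; rewrite [X in (_ <= X)%E]EFinM lee_pmul2l//; exact/ltW/Gi.
under eq_integral do rewrite -sumEFin.
have sF i s : I01 s -> (0 <= (\sum_j F i j s)%:E)%E by rewrite lee_fin sumr_ge0.
have mS i : measurable_fun I01 (fun s => (\sum_j F i j s)%:E).
  by apply/measurable_EFinP; apply: measurable_sum => j; exact: mF.
rewrite (ge0_integral_sum mu mI mS sF).
apply: (@le_trans _ _ (\sum_(i < D) \sum_(j < D) (4 * c ^+ 2)%:E)%E).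
  apply: lee_sum => i _; under eq_integral do rewrite -sumEFin.
  have FE0 j s : I01 s -> (0 <= (F i j s)%:E)%E by rewrite lee_fin.
  have mFE j : measurable_fun I01 (fun s => (F i j s)%:E) by apply/measurable_EFinP.
  rewrite (ge0_integral_sum mu mI mFE FE0).
  by apply: lee_sum.
under eq_bigr do rewrite sumEFin; rewrite sumEFin lee_fin.
rewrite !sumr_const !card_ord -mulrnA -[_ *+ (D * D)]mulr_natr natrM /c.
rewrite expr_div_n exprMn (_ : 4 * _ * _ = e ^+ 2 * ((D%:R * D%:R) / D.+1%:R ^+ 2)); last by field.
rewrite ler_piMr ?sqr_ge0// ler_pdivrMr ?exprn_gt0// mul1r expr2 -!natr1.
by have : 0 <= D%:R :> R by []; nra.
Qed.

Lemma step_proj_cvg (v : L2 R D) (e : R) : 0 < e ->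
  \forall j \near net_filter J, `|v - step_lift (step_proj j v)| <= e.
Proof.
move=> e0; have FF := net_filter_proper genJ.
have e2 : 0 < e / 2 by rewrite divr_gt0.
apply: filterS (step_approx v e2) => j [x vx].
by have := step_proj_dist_le v x; lra.
Qed.

End Projections.

(** * Compactness *)

Section Within.
Context (R : realType) (V W : normedModType R).

Lemma near_within_ballP (A : set V) (z : V) (P : V -> Prop) :
  (\forall w \near within A (nbhs z), P w) <->
  exists2 r : R, 0 < r & forall w, A w -> `|z - w| < r -> P w.
Proof.
split=> [h|[r r0 h]].
  have /nbhs_ballP[r /= r0 hr] : nbhs z (fun w => A w -> P w) by exact: h.
  by exists r => // w Aw zw; apply: hr => //; rewrite -ball_normE.
apply/nbhs_ballP; exists r => // w; rewrite -ball_normE => zw Aw; exact: h.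
Qed.

Lemma within_continuousP (A : set V) (f : V -> W) :
  {within A, continuous f} <->
  forall z, A z -> forall e, 0 < e ->
    exists2 r, 0 < r & forall w, A w -> `|z - w| < r -> `|f z - f w| <= e.
Proof.
split=> [/subspace_continuousP cf z Az e e0|cf].
  by apply/near_within_ballP; have /cvgrPdist_le/(_ e e0) := cf z Az.
apply/subspace_continuousP => z Az; apply/cvgrPdist_le => e e0.
exact/near_within_ballP/cf.
Qed.

Lemma prod_norm_lt (x : V * W) (r : R) : (`|x| < r) = (`|x.1| < r) && (`|x.2| < r).
Proof. by rewrite prod_normE gt_max. Qed.

Lemma prod_norm_le (x : V * W) (r : R) : (`|x| <= r) = (`|x.1| <= r) && (`|x.2| <= r).
Proof. by rewrite prod_normE ge_max. Qed.

Lemma norm_fst_le (x : V * W) : `|x.1| <= `|x|.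
Proof. by rewrite prod_normE le_max lexx. Qed.

Lemma norm_snd_le (x : V * W) : `|x.2| <= `|x|.
Proof. by rewrite prod_normE le_max lexx orbT. Qed.

End Within.

Section FiniteDimension.
Context (R : realType) (V : innerProductType R).

(** By Cauchy-Schwarz the coefficients of a ball lie in a compact box, whose continuous image
    contains the ball. A reconstruction formula in place of a basis admits redundant families, such
    as the matrices [sym_unit a b] and [sym_unit b a], which coincide. *)
Lemma spanned_ball_compact N (e d : 'I_N -> V) (M : R) :
  (forall x, x = \sum_m inner x (d m) *: e m) ->
  compact [set x : V | `|x| <= M].
Proof.
move=> spanV; pose T (c : 'rV[R]_N) : V := \sum_m c ord0 m *: e m.
have cT : continuous T.
  apply: continuous_big => [|m _]; first exact: add_continuous.
  move=> c; have h : c' ord0 m @[c' --> c] --> c ord0 m by exact: coord_continuous.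
  exact: (@cvgZr_tmp R V _ (nbhs c) _ (fun c0 => c0 ord0 m) (c ord0 m) (e m) h).
pose K m := M * `|d m|.
have cB : compact [set c : 'rV[R]_N | forall m, `[- K m, K m]%classic (c ord0 m)].
  by have := @rV_compact R N (fun m => `[- K m, K m]%classic) (fun m => @segment_compact R _ _).
have cI := @continuous_compact _ _ T _ (continuous_subspaceT cT) cB.
have cM : closed [set x : V | `|x| <= M].
  apply: (@closed_comp _ _ (fun x : V => `|x|) [set r | r <= M]); last exact: closed_le.
  by move=> x _; exact: norm_continuous.
refine (subclosed_compact cM cI _) => x /= xM; exists (\row_m inner x (d m)).
  move=> m; rewrite /= mxE in_itv /= -ler_norml.
  by rewrite (le_trans (cauchy_schwarz _ _))// ler_wpM2r.
by rewrite [RHS]spanV; apply: eq_bigr => m _; rewrite mxE.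
Qed.

End FiniteDimension.

Section StepCompact.
Context (R : realType) (D : nat) (j : partition01 R).
Notation SD := (symmx R D).
Notation n := (size j).

Lemma sym_unit_subproof (a b : 'I_D) :
  (2^-1 *: (delta_mx a b + delta_mx b a) : 'M[R]_D) \in @sym_pred R D.
Proof. by apply/eqP; rewrite linearZ linearD /= !trmx_delta addrC. Qed.

Definition sym_unit (a b : 'I_D) : SD := Symmx (sym_unit_subproof a b).

Lemma sum_delta (F : 'I_D -> 'I_D -> R) a b :
  \sum_i \sum_k F i k * ((a == i) && (b == k))%:R = F a b.
Proof.
rewrite (bigD1 a)//= (bigD1 b)//= !eqxx mulr1 !big1 ?addr0// => i ia.
  by rewrite big1// => k _; rewrite eq_sym (negPf ia) mulr0.
by rewrite [b == i]eq_sym (negPf ia) andbF mulr0.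
Qed.

Lemma sym_unit_entry a b i k :
  sym_unit a b i k = 2^-1 * (((i == a) && (k == b))%:R + ((i == b) && (k == a))%:R).
Proof. by rewrite !mxE. Qed.

Lemma inner_sym_unit (x : SD) a b : inner x (sym_unit a b) = x a b.
Proof.
rewrite symmx_innerE.
transitivity (\sum_i \sum_k (x i k / 2 * ((a == i) && (b == k))%:R +
    x i k / 2 * ((b == i) && (a == k))%:R)).
  apply: eq_bigr => i _; apply: eq_bigr => k _; rewrite sym_unit_entry.
  by rewrite ![_ == i]eq_sym ![_ == k]eq_sym; ring.
under eq_bigr do rewrite big_split /=; rewrite big_split /= !sum_delta.
by rewrite (symmxE x b a); field.
Qed.

Lemma symmx_span (x : SD) : x = \sum_a \sum_b x a b *: sym_unit a b.
Proof.
apply/inner_separated => y; rewrite inner_suml symmx_innerE; apply: eq_bigr => a _.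
rewrite inner_suml; apply: eq_bigr => b _.
by rewrite innerZl innerC inner_sym_unit.
Qed.

Definition step_delta (k : 'I_n) (b : SD) : stepfun D j :=
  [ffun l : 'I_n => if l == k then b else 0].

Lemma inner_step_delta x k b : inner x (step_delta k b) = width k * inner (x k) b.
Proof.
rewrite -[LHS]/(step_inner _ _) /step_inner (bigD1 k)//= big1 ?addr0.
  by rewrite ffunE eqxx.
by move=> l lk; rewrite ffunE (negPf lk) innerC inner0l mulr0.
Qed.

Lemma step_ball_compact (M : R) : compact [set x : stepfun D j | `|x| <= M].
Proof.
pose K := ('I_n * 'I_D * 'I_D)%type.
pose e (q : 'I_#|{: K}|) := let: (k, a, b) := enum_val q in step_delta k (sym_unit a b).
(* The inverse width undoes the weight in the inner product of [stepfun]. *)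
pose d (q : 'I_#|{: K}|) := let: (k, a, b) := enum_val q in
  (width k)^-1 *: step_delta k (sym_unit a b).
apply: (@spanned_ball_compact _ _ _ e d) => x.
pose F (q : K) := let: (k, a, b) := q in (x k) a b *: step_delta k (sym_unit a b).
transitivity (\sum_q F q).
  have -> : \sum_q F q = \sum_k \sum_a \sum_b F (k, a, b).
    by rewrite !pair_bigA /=; apply: eq_bigr => -[[k a] b].
  apply/inner_separated => y; rewrite inner_suml -[LHS]/(step_inner x y).
  apply: eq_bigr => k _; rewrite {1}[x k]symmx_span !inner_suml mulr_sumr.
  apply: eq_bigr => a _; rewrite !inner_suml mulr_sumr; apply: eq_bigr => b _.
  by rewrite !innerZl [in RHS]innerC inner_step_delta mulrCA innerC.
rewrite (reindex (@enum_val _ {: K})) /=; last first.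
  by exists enum_rank => q _; rewrite ?enum_valK ?enum_rankK.
apply: eq_bigr => q _; rewrite /F /e /d; case: (enum_val q) => [[k a] b].
rewrite innerZr inner_step_delta mulrA mulVf ?mul1r ?gt_eqF ?width_gt0//.
by rewrite inner_sym_unit.
Qed.

End StepCompact.

(** * Differentials *)

Section Calculus.
Context (R : realType) (X : innerProductType R).
Implicit Types (dom : set X) (phi : R * X -> R) (z d w : R * X).

Lemma quadratic_is_diff dom phi z d (K : R) :
  (\forall w \near within (otime_dom dom) (nbhs z),
     `|taylor_error phi z d w| <= K * (`|w.1 - z.1| ^+ 2 + `|w.2 - z.2| ^+ 2)) ->
  is_diff_at dom phi z d.
Proof.
move=> /near_within_ballP[r r0 h] e e0; apply/near_within_ballP.
have K0 : 0 < `|K| + 1 by rewrite ltr_wpDl.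
(* Within this radius [K] times either distance is at most [e], so one factor of each square is
   absorbed. *)
exists (Num.min r (e / (`|K| + 1))); first by rewrite lt_min r0 divr_gt0.
move=> w dw; rewrite lt_min => /andP[zr ze]; apply: (le_trans (h w dw zr)).
move: ze; rewrite distrC ltr_pdivlMr// => ze.
have a1 := norm_fst_le (w - z); have a2 := norm_snd_le (w - z).
rewrite /= in a1 a2; set a := `|w.1 - z.1| in a1 *; set b := `|w.2 - z.2| in a2 *.
have a0 : 0 <= a := normr_ge0 _; have b0 : 0 <= b := normr_ge0 _.
have KK := ler_norm K; have KN : 0 <= `|K| by [].
have c1 : `|K| * a <= e by nra.
have c2 : `|K| * b <= e by nra.
nra.
Qed.

Lemma diff_of_diffs_small dom phi z d d' :
  is_diff_at dom phi z d -> is_diff_at dom phi z d' -> forall e, 0 < e ->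
  exists2 r, 0 < r & forall w, otime_dom dom w -> `|z - w| < r ->
    `|(d.1 - d'.1) * (w.1 - z.1) + inner (d.2 - d'.2) (w.2 - z.2)| <=
      e * (`|w.1 - z.1| + `|w.2 - z.2|).
Proof.
move=> h h' e e0; have e2 : 0 < e / 2 by rewrite divr_gt0.
have /near_within_ballP[r r0 hr] := h _ e2.
have /near_within_ballP[r' r0' hr'] := h' _ e2.
exists (Num.min r r'); first by rewrite lt_min r0.
move=> w dw; rewrite lt_min => /andP[zr zr'].
have := hr w dw zr; have := hr' w dw zr'; rewrite /taylor_error !ler_norml innerBl; lra.
Qed.

(** A linear function on a ray that is [o(s)] vanishes; [b] stands for the length of the direction.
    The choice of [e] below makes [e * b] smaller than the modulus of [a]. *)
Lemma small_slope (a : R) (b : R) (r : R -> R) :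
  (forall e, 0 < e -> 0 < r e) ->
  (forall e s, 0 < e -> 0 < s -> s < r e -> `|a * s| <= e * (s * b)) -> a = 0.
Proof.
move=> r0 h; apply/eqP; rewrite -normr_eq0 eq_le normr_ge0 andbT leNgt; apply/negP => a0.
have bp : 0 < `|b| + 1 by rewrite ltr_wpDl.
pose e := `|a| / (2 * (`|b| + 1)).
have e0 : 0 < e by rewrite divr_gt0// mulr_gt0.
have re := r0 e e0; pose s := r e / 2.
have s0 : 0 < s by rewrite divr_gt0.
have := h e s e0 s0; rewrite normrM (gtr0_norm s0) (_ : e * (s * b) = e * b * s); last by ring.
rewrite ler_pM2r//.
have -> : s < r e by rewrite /s; lra.
have eE : e * (2 * (`|b| + 1)) = `|a| by rewrite /e divfK// mulf_neq0// gt_eqF.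
have bb := ler_norm b.
have : e * b <= e * `|b| by rewrite ler_wpM2l// ltW.
by move=> h1 /(_ isT); have : 0 <= `|b| by []; nra.
Qed.

(* A cone which spans the space has enough admissible directions to determine
   the differential. *)
Lemma cone_diff_unique dom phi z d d' :
  (forall x y, dom x -> dom y -> dom (x + y)) ->
  (forall (c : R) x, 0 <= c -> dom x -> dom (c *: x)) ->
  (forall v, exists x y, [/\ dom x, dom y & v = x - y]) ->
  otime_dom dom z -> is_diff_at dom phi z d -> is_diff_at dom phi z d' -> d = d'.
Proof.
move=> domD domZ span [z0 dz] h h'.
have /(_ _ _)/cid2 T := diff_of_diffs_small h h'.
pose r e := if pselect (0 < e) is left e0 then s2val (T e e0) else 1.
have r0 e : 0 < e -> 0 < r e.
  by move=> e0; rewrite /r; case: pselect => // ?; exact: (s2valP (T e _)).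
have hr e w : 0 < e -> otime_dom dom w -> `|z - w| < r e ->
    `|(d.1 - d'.1) * (w.1 - z.1) + inner (d.2 - d'.2) (w.2 - z.2)| <=
      e * (`|w.1 - z.1| + `|w.2 - z.2|).
  by move=> e0; rewrite /r; case: pselect => // e0'; exact: (s2valP' (T e e0')).
have d1 : d.1 - d'.1 = 0.
  apply: (small_slope r0 (b := 1)) => e s e0 s0 sr.
  have := hr e (z.1 + s, z.2) e0; rewrite /= subrr normr0 innerC inner0l !addr0 mulr1.
  rewrite [z.1 + s]addrC addrK (gtr0_norm s0); apply.
    by split=> //=; rewrite addr_gt0.
  by rewrite prod_norm_lt /= subrr normr0 opprD addrCA subrr addr0 normrN (gtr0_norm s0) sr r0.
(* Moving from [z.2] along [y] stays in the cone even if [z.2] is on its boundary; spanning then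
   extends the conclusion to all directions. *)
have d2 y : dom y -> inner (d.2 - d'.2) y = 0.
  move=> dy; have y1 : 0 < `|y| + 1 by rewrite ltr_wpDl.
  apply: (small_slope (r := fun e => r e / (`|y| + 1)) (b := `|y|)).
    by move=> e e0; rewrite divr_gt0// r0.
  move=> e s e0 s0; rewrite ltr_pdivlMr// => sr.
  have := hr e (z.1, z.2 + s *: y) e0; rewrite /= subrr normr0 mulr0 !add0r.
  rewrite [z.2 + _]addrC addrK innerZr (normrZ s y) (gtr0_norm s0) [inner _ y * s]mulrC; apply.
    by split=> //=; apply: domD => //; apply: domZ => //; exact: ltW.
  rewrite prod_norm_lt /= subrr normr0 r0//= opprD addrCA subrr addr0 normrN normrZ (gtr0_norm s0).
  by apply: le_lt_trans sr; rewrite ler_pM2l// lerDl.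
apply/eqP; rewrite -subr_eq0; apply/eqP; rewrite [LHS]surjective_pairing /= d1; congr pair.
apply/eqP; rewrite -normr_eq0 -sqrf_eq0 sqr_norm_inner; apply/eqP.
have [x [y [dx dy e]]] := span (d.2 - d'.2).
by rewrite [in X in inner _ X]e innerBr !d2// subrr.
Qed.

End Calculus.

Section Smooth.
Context (R : realType) (X : innerProductType R).
Implicit Types (dom : set X) (phi : R * X -> R) (z d w : R * X).

Lemma smooth_continuous dom phi dphi z : smooth dom phi dphi -> otime_dom dom z ->
  forall e, 0 < e -> exists2 r, 0 < r &
    forall w, otime_dom dom w -> `|z - w| < r -> `|phi z - phi w| <= e.
Proof.
move=> [sd _ _] dz e e0; have [hd _] := sd z dz.
have /near_within_ballP[r r0 hr] := hd 1 ltr01.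
(* The summand 2 accounts for the Taylor error, bounded by the sum of two distances that are each at
   most the max norm of [w - z]. *)
pose M := `|(dphi z).1| + `|(dphi z).2| + 2.
have M0 : 0 < M by rewrite ltr_wpDl// addr_ge0.
exists (Num.min r (e / M)); first by rewrite lt_min r0 divr_gt0.
move=> w dw; rewrite lt_min => /andP[zr ze].
have := hr w dw zr; rewrite mul1r /taylor_error.
have a1 := norm_fst_le (w - z); have a2 := norm_snd_le (w - z).
rewrite distrC ltr_pdivlMr// in ze; rewrite /= in a1 a2.
have b1 : `|(dphi z).1 * (w.1 - z.1)| <= `|(dphi z).1| * `|w - z|.
  by rewrite normrM ler_wpM2l.
have b2 : `|inner (dphi z).2 (w.2 - z.2)| <= `|(dphi z).2| * `|w - z|.
  by rewrite (le_trans (cauchy_schwarz _ _))// ler_wpM2l.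
move: b1 b2 ze; rewrite /M !mulrDr ![`|w - z| * _]mulrC !ler_norml; lra.
Qed.

Lemma taylor_errorN phi z d w :
  taylor_error (fun y => - phi y) z (- d) w = - taylor_error phi z d w.
Proof. by rewrite /taylor_error /= innerNl; ring. Qed.

Lemma is_diffN dom phi z d :
  is_diff_at dom phi z d -> is_diff_at dom (fun y => - phi y) z (- d).
Proof.
move=> h e e0; apply: filterS (h e e0) => w hw.
by rewrite taylor_errorN normrN.
Qed.

Lemma smoothN dom phi dphi :
  smooth dom phi dphi -> smooth dom (fun y => - phi y) (fun y => - dphi y).
Proof.
move=> [h1 h2 h3]; split.
- move=> z dz; have [hd hu] := h1 z dz; split; first exact: is_diffN.
  move=> d /is_diffN; rewrite (_ : (fun y => - - phi y) = phi).
    by move/hu => <-; rewrite opprK.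
  by apply/funext => y; rewrite opprK.
- move=> z dz; have [K hK] := h2 z dz; exists K.
  by apply: filterS hK => w hw; rewrite taylor_errorN normrN.
- apply: (@within_continuousP R (R * X)%type (R * X)%type _ _).2 => z dz e e0.
  have [r r0 hr] := (@within_continuousP R (R * X)%type (R * X)%type _ _).1 h3 z dz e e0.
  by exists r => // w dw zw; rewrite -opprD normrN; exact: hr.
Qed.

End Smooth.

(** * The penalized test function *)

Section SmoothLift.
Context (R : realType) (D : nat) (j : partition01 R).
Variables (phi : R * L2 R D -> R) (dphi : R * L2 R D -> R * L2 R D).
Hypothesis sphi : smooth (coneC R D) phi dphi.
Variable z : R * L2 R D.
Implicit Types w y : R * stepfun D j.

Definition time_lift w : R * L2 R D := (w.1, step_lift w.2).

(* The quadratic penalty turns a local maximum at z into a strict one. *)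
Definition penalized w : R :=
  phi (time_lift w) + ((w.1 - z.1) ^+ 2 + `|step_lift w.2 - z.2| ^+ 2).

(** Chain rule: the gradient of a composition with [step_lift] is the adjoint [step_proj] applied to
    the gradient. *)
Definition dpenalized w : R * stepfun D j :=
  ((dphi (time_lift w)).1 + 2 * (w.1 - z.1),
   step_proj j ((dphi (time_lift w)).2 + 2 *: (step_lift w.2 - z.2))).

Lemma time_lift_dom w : otime_dom (step_cone D j) w -> otime_dom (coneC R D) (time_lift w).
Proof. by move=> [w0 cw]; split=> //=; exact: step_lift_cone. Qed.

Lemma norm_time_liftB y w : `|time_lift y - time_lift w| = `|y - w|.
Proof. by rewrite !prod_normE /= -step_liftB norm_step_lift. Qed.

Lemma taylor_error_penalized y w :
  taylor_error penalized y (dpenalized y) w =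
  taylor_error phi (time_lift y) (dphi (time_lift y)) (time_lift w) +
  ((w.1 - y.1) ^+ 2 + `|w.2 - y.2| ^+ 2).
Proof.
rewrite /taylor_error /penalized /dpenalized /= step_adjoint innerDl innerZl.
rewrite -[`|w.2 - y.2|]norm_step_lift step_liftB.
set a := step_lift w.2; set b := step_lift y.2; set h := z.2.
rewrite !sqr_norm_inner !innerBl !innerBr !(innerC h) (innerC b a).
by ring.
Qed.

Lemma penalized_quadratic y : otime_dom (step_cone D j) y -> exists K : R,
  \forall w \near within (otime_dom (step_cone D j)) (nbhs y),
    `|taylor_error penalized y (dpenalized y) w| <=
      K * (`|w.1 - y.1| ^+ 2 + `|w.2 - y.2| ^+ 2).
Proof.
move=> dy; have [_ h2 _] := sphi.
have [K /near_within_ballP[r r0 hr]] := h2 _ (time_lift_dom dy).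
exists (K + 1); apply/near_within_ballP; exists r => // w dw yw.
have := hr _ (time_lift_dom dw); rewrite norm_time_liftB => /(_ yw) /=.
rewrite -step_liftB norm_step_lift taylor_error_penalized => h.
rewrite (le_trans (ler_normD _ _))// mulrDl mul1r lerD//.
by rewrite ger0_norm ?addr_ge0 ?sqr_ge0// real_normK ?num_real.
Qed.

Lemma smooth_penalized : smooth (step_cone D j) penalized dpenalized.
Proof.
split; last 1 first.
- apply: (@within_continuousP R (R * stepfun D j)%type (R * stepfun D j)%type _ _).2 => y dy e e0.
  have [_ _ h3] := sphi.
  have e4 : 0 < e / 4 by rewrite divr_gt0.
  have [r r0 hr] := (@within_continuousP R (R * L2 R D)%type (R * L2 R D)%type _ _).1 h3 _ (time_lift_dom dy) _ e4.
  exists (Num.min r (e / 4)); first by rewrite lt_min r0.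
  move=> w dw; rewrite lt_min => /andP[yr ye].
  have := hr _ (time_lift_dom dw); rewrite norm_time_liftB => /(_ yr).
  rewrite !prod_norm_le /= => /andP[k1 k2].
  have a1 := norm_fst_le (y - w); have a2 := norm_snd_le (y - w).
  rewrite /= in a1 a2; apply/andP; split.
    rewrite (_ : _ - _ = ((dphi (time_lift y)).1 - (dphi (time_lift w)).1) +
      2 * (y.1 - w.1)); last by ring.
    by rewrite (le_trans (ler_normD _ _))// normrM (@ger0_norm _ 2)//; lra.
  rewrite -step_projB (le_trans (norm_step_proj _ _))// opprD addrACA -scalerBr.
  rewrite (le_trans (ler_normD _ _))// normrZ (@ger0_norm _ 2)//.
  rewrite opprB addrA subrK -step_liftB norm_step_lift; lra.
- move=> y dy; have [K hK] := penalized_quadratic dy; split; first exact: quadratic_is_diff hK.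
  move=> d hd; apply: (cone_diff_unique (dom := step_cone D j) _ _ _ dy hd).
  + exact: step_coneD.
  + exact: step_coneZ.
  + exact: step_cone_spans.
  + exact: quadratic_is_diff hK.
- exact: penalized_quadratic.
Qed.

End SmoothLift.

(** * Passing to the limit *)

Section Convergence.
Context (R : realType) (D : nat) (J : set (partition01 R)).
Variables (f_ : forall j : partition01 R, R * stepfun D j -> R) (f : R * L2 R D -> R).
Arguments f_ : clear implicits.
Hypothesis genJ : generating_partitions J.

Definition locally_uniform_cvg : Prop :=
  forall z r e, time_dom (coneC R D) z -> 0 < e ->
  \forall j \near net_filter J, forall w, time_dom (coneC R D) w -> `|w - z| <= r ->
    `|f w - f_ j (w.1, step_proj j w.2)| <= e.

Lemma family_locally_uniform :
  {family closed_balls (coneC R D), (fun j => pullback (f_ j)) @ net_filter J --> f} ->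
  locally_uniform_cvg.
Proof.
move=> f_cvg z r e dz e0; have FF := net_filter_proper genJ.
pose B := time_dom (coneC R D) `&` [set w | `|w - z| <= r].
have cB : closed_balls (coneC R D) B by exists z, r.
have /fam_cvgP/(_ B cB) h := f_cvg.
pose Q := [set h : R * L2 R D -> R | forall w, B w -> ball (f w) e (h w)].
have nQ : nbhs (f : {uniform` B -> R}) Q.
  apply/uniform_nbhs; exists [set xy | ball xy.1 e xy.2]; split => //.
  exact: (@entourage_ball _ _ (PosNum e0)).
have : \forall j \near net_filter J, Q (pullback (f_ j)) by exact: h nQ.
apply: filterS => j hj w dw wz; apply: ltW; exact: (hj w (conj dw wz)).
Qed.

Hypothesis f_cvg : locally_uniform_cvg.

Lemma norm_time_proj_le (j : partition01 R) (z w : R * L2 R D) :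
  `|(z.1, step_proj j z.2) - (w.1, step_proj j w.2)| <= `|z - w|.
Proof.
rewrite prod_norm_le /=; apply/andP; split; first exact: (norm_fst_le (z - w)).
rewrite -step_projB (le_trans (norm_step_proj _ _))//.
exact: (norm_snd_le (z - w)).
Qed.

(** A three-epsilon argument with a single member [j]: its pullback is continuous because
    [step_proj] is a contraction that maps [coneC] into [step_cone]. *)
Lemma limit_continuous :
  (forall j, J j -> {within time_dom (step_cone D j), continuous (f_ j)}) ->
  {within time_dom (coneC R D), continuous f}.
Proof.
move=> cf; have FF := net_filter_proper genJ.
apply: (@within_continuousP R (R * L2 R D)%type R^o _ _).2 => z dz e e0.
have e3 : 0 < e / 3 by rewrite divr_gt0.
have [j [Jj hj]] := filter_ex (filterI (near_member genJ) (@f_cvg z 1 _ dz e3)).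
have dzj : time_dom (step_cone D j) (z.1, step_proj j z.2).
  by split; [exact: dz.1|exact: step_proj_cone dz.2].
have [r r0 hr] := (@within_continuousP R (R * stepfun D j)%type R^o _ _).1 (cf j Jj) _ dzj _ e3.
exists (Num.min r 1); first by rewrite lt_min r0 ltr01.
move=> w dw; rewrite lt_min => /andP[zr z1].
have dwj : time_dom (step_cone D j) (w.1, step_proj j w.2).
  by split; [exact: dw.1|exact: step_proj_cone dw.2].
have k1 := hj z dz; have k2 := hj w dw.
have k3 := hr _ dwj (le_lt_trans (norm_time_proj_le j z w) zr).
have {}k1 : `|f z - f_ j (z.1, step_proj j z.2)| <= e / 3.
  by apply: k1; rewrite subrr normr0.
have {}k2 : `|f w - f_ j (w.1, step_proj j w.2)| <= e / 3.
  by apply: k2; rewrite distrC ltW.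
by move: k1 k2 k3; rewrite /= !ler_norml; lra.
Qed.

End Convergence.

(** * Compactness of the sets over which the maximum is taken *)

Section Maximizer.
Context (R : realType) (D : nat) (j : partition01 R) (z : R * L2 R D) (r : R).

(** The centre [z] need not be a lift, so distances are measured after lifting. Positivity of time
    is left out to keep the set closed; a radius [r < z.1] restores it. *)
Definition cone_ball : set (R * stepfun D j) :=
  [set w | step_cone D j w.2 /\ `|z - time_lift w| <= r].

Lemma cone_ball_compact : compact cone_ball.
Proof.
have cT := @compact_setX _ _ _ _ (@segment_compact R (z.1 - r) (z.1 + r))
  (@step_ball_compact R D j (`|z.2| + r)).
refine (subclosed_compact _ cT _); last first.
  move=> w [_]; rewrite prod_norm_le /= => /andP[w1 w2]; split=> /=.
    by move: w1; rewrite in_itv /= ler_norml; lra.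
  have := ler_normB z.2 (z.2 - step_lift w.2).
  by rewrite opprB addrCA subrr addr0 norm_step_lift; lra.
rewrite (_ : cone_ball = (@snd R (stepfun D j)) @^-1` step_cone D j `&`
  (fun w => `|z - time_lift w|) @^-1` [set s | s <= r]); last by [].
apply: closedI; apply: closed_comp.
- by move=> w _; exact: cvg_snd.
- exact: closed_step_cone.
- move=> w _; apply/cvgrPdist_le => e e0.
  have hb : nbhs w (ball w e) by exact: nbhsx_ballx.
  apply: filterS hb => y; rewrite -ball_normE /= => /ltW; apply: le_trans.
  rewrite -norm_time_liftB (le_trans (ler_dist_dist _ _))//.
  by rewrite opprB addrC addrA subrK distrC.
- exact: closed_le.
Qed.

End Maximizer.

(** * The limit of subsolutions *)

Section Subsolution.
Context (R : realType) (D : nat) (G : L2 R D -> R) (J : set (partition01 R)).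
Variables (f_ : forall j : partition01 R, R * stepfun D j -> R) (f : R * L2 R D -> R).
Arguments f_ : clear implicits.
Hypothesis cG : continuous G.
Hypothesis genJ : generating_partitions J.
Hypothesis f_cvg : locally_uniform_cvg J f_ f.
Hypothesis f_sub : forall j, J j ->
  viscosity_subsolution (step_cone D j) (G \o @step_lift R D j) (f_ j).

(* The maximizer of f_j minus the penalized test function over a ball around z
   lies in its interior: evaluating at the projection of z shows that the penalty
   there is small. *)
Lemma interior_maximizer (phi : R * L2 R D -> R) dphi (z : R * L2 R D) (r : R) :
  smooth (coneC R D) phi dphi -> otime_dom (coneC R D) z -> 0 < r -> r < z.1 ->
  (forall w, otime_dom (coneC R D) w -> `|z - w| <= r -> f w - phi w <= f z - phi z) ->
  \forall j \near net_filter J, exists y : R * stepfun D j,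
    [/\ otime_dom (step_cone D j) y, `|z - time_lift y| < r &
        \forall w \near within (otime_dom (step_cone D j)) (nbhs y),
          f_ j w - penalized phi z w <= f_ j y - penalized phi z y].
Proof.
move=> sphi dz r0 rz zmax; have FF := net_filter_proper genJ.
(* Four errors of at most [q] bound the penalty at the maximizer [y]: the convergence at [z] and at
   the lift of [y], the variation of [phi] between [z] and the lift of [zp], and the penalty at
   [zp]. Their sum [r ^+ 2 / 2] is below [r ^+ 2]. *)
pose q := r ^+ 2 / 8; have q0 : 0 < q by rewrite divr_gt0// exprn_gt0.
have [r2 r20 hr2] := smooth_continuous sphi dz q0.
(* The first bound controls the variation of [phi], the second makes the penalty at [zp] at most
   [r ^+ 2 / 16]. *)
pose s := Num.min (r2 / 2) (r / 4).
have s0 : 0 < s by rewrite lt_min !divr_gt0.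
have sr2 : s < r2 by rewrite /s gt_min; apply/orP; left; lra.
have sr : s <= r / 4 by rewrite /s ge_min lexx orbT.
have dz' : time_dom (coneC R D) z by split; [exact/ltW/dz.1|exact: dz.2].
apply: filterS (filterI (near_member genJ) (filterI (@f_cvg z r _ dz' q0)
  (step_proj_cvg genJ z.2 s0))) => j [Jj [hj zj]].
pose zp : R * stepfun D j := (z.1, step_proj j z.2).
have dzp : otime_dom (step_cone D j) zp.
  by split; [exact: dz.1|exact: step_proj_cone dz.2].
have zzp : `|z - time_lift zp| <= s by rewrite prod_norm_le /= subrr normr0 ltW.
have ball_dom w : cone_ball z r w -> otime_dom (step_cone D j) w.
  move=> [cw zw]; split => //; have := norm_fst_le (z - time_lift w).
  by rewrite /=; have := ler_norm (z.1 - w.1); lra.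
have spen := @smooth_penalized R D j phi dphi sphi z.
have cfj : {within cone_ball z r, continuous (fun w => f_ j w - penalized phi z w)}.
  apply: (@within_continuousP R (R * stepfun D j)%type R^o _ _).2 => y By e e0.
  have e2 : 0 < e / 2 by rewrite divr_gt0.
  have dy := ball_dom y By.
  have dy' : time_dom (step_cone D j) y by split; [exact/ltW/dy.1|exact: dy.2].
  have [a a0 ha] := smooth_continuous spen dy e2.
  have [b b0 hb] := (@within_continuousP R (R * stepfun D j)%type R^o _ _).1 (f_sub Jj).1 _ dy' _ e2.
  exists (Num.min a b); first by rewrite lt_min a0.
  move=> w Bw; rewrite lt_min => /andP[ya yb]; have dw := ball_dom w Bw.
  have dw' : time_dom (step_cone D j) w by split; [exact/ltW/dw.1|exact: dw.2].
  by have := ha w dw ya; have := hb w dw' yb; rewrite !ler_norml; lra.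
have Bzp : cone_ball z r zp by split; [exact: dzp.2|lra].
have [y /set_mem By ymax] := compact_EVT_max (ex_intro _ zp Bzp) (@cone_ball_compact R D j z r) cfj.
have dy := ball_dom y By; have ly := time_lift_dom dy.
have zy : `|z - time_lift y| < r.
  have k1 := ymax zp (mem_set Bzp).
  have k2 : `|f z - f_ j (z.1, step_proj j z.2)| <= q.
    by apply: hj => //; rewrite subrr normr0 ltW.
  have ly' : time_dom (coneC R D) (time_lift y) by split; [exact/ltW/ly.1|exact: ly.2].
  (* At a lift the pullback of [f_ j] is [f_ j] itself, so uniform convergence compares [f_ j y]
     with [f] at the lift of [y]. *)
  have k3 := hj _ ly'; rewrite distrC /= step_projK in k3.
  have {}k3 := k3 By.2.
  have k4 := hr2 _ (time_lift_dom dzp) (le_lt_trans zzp sr2).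
  have k5 := zmax _ ly By.2.
  rewrite /penalized /= subrr expr0n /= add0r in k1.
  rewrite distrC in zj.
  have k6 : `|step_lift (step_proj j z.2) - z.2| ^+ 2 <= q.
    by have : 0 <= `|step_lift (step_proj j z.2) - z.2| by []; rewrite /q; nra.
  have k7 : (y.1 - z.1) ^+ 2 + `|step_lift y.2 - z.2| ^+ 2 < r ^+ 2.
    have : r ^+ 2 = 8 * q by rewrite /q; field.
    rewrite -surjective_pairing in k3.
    by move: k1 k2 k3 k4 k5; rewrite /zp /= !ler_norml; lra.
  have p1 := sqr_ge0 (y.1 - z.1); have p2 := sqr_ge0 `|step_lift y.2 - z.2|.
  rewrite prod_norm_lt /= [`|z.1 - _|]distrC [`|z.2 - _|]distrC.
  rewrite -[X in X && _](@ltr_pXn2r _ 2)// ?nnegrE ?(ltW r0)//.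
  rewrite -[X in _ && X](@ltr_pXn2r _ 2)// ?nnegrE ?(ltW r0)//.
  by rewrite real_normK ?num_real//; lra.
exists y; split=> //; apply/near_within_ballP.
exists (r - `|z - time_lift y|); first by rewrite subr_gt0.
move=> w dw yw; apply: ymax; apply/mem_set; split; first exact: dw.2.
have := ler_normD (z - time_lift y) (time_lift y - time_lift w).
by rewrite addrA subrK norm_time_liftB; lra.
Qed.

Lemma limit_subsolution : viscosity_subsolution (coneC R D) G f.
Proof.
have FF := net_filter_proper genJ.
split; first by apply: (limit_continuous genJ f_cvg) => j Jj; exact: (f_sub Jj).1.
move=> phi dphi z sphi dz /near_within_ballP[r0 r00 zmax].
apply/ler_addgt0Pr => e e0; rewrite add0r.
have e3 : 0 < e / 3 by rewrite divr_gt0.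
have /cvgrPdist_le/(_ _ e3)/nbhs_ballP[a /= a0 ha] := @cG (dphi z).2.
(* [b] bounds both the variation of [dphi] and the derivative of the penalty. In the time derivative
   each costs at most [e / 3], leaving [e / 3] for [G]; in the gradient each costs at most [a / 4],
   and the projection error another [a / 4]. *)
have [b [b0 be ba]] : exists b, [/\ 0 < b, b <= e / 3 & b <= a / 4].
  by exists (Num.min (e / 3) (a / 4)); rewrite lt_min e3 divr_gt0// !ge_min !lexx orbT.
have [_ _ cdphi] := sphi.
have [r1 r10 hr1] := (@within_continuousP R (R * L2 R D)%type (R * L2 R D)%type _ _).1 cdphi z dz b b0.
have z1 : 0 < z.1 := dz.1.
have [m [m0 [m1 m2] m3 m4]] : exists m, [/\ 0 < m, m <= r0 /\ m <= r1, m <= z.1 & m <= b].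
  exists (Num.min (Num.min r0 r1) (Num.min z.1 b)).
  by rewrite !lt_min r00 r10 z1 b0 !ge_min !lexx !orbT.
pose r := m / 2.
have r_gt0 : 0 < r by rewrite divr_gt0.
have [rr0 rr1 rz rb] : [/\ r < r0, r < r1, r < z.1 & 2 * r <= b].
  by rewrite /r; split; lra.
have zmax' w : otime_dom (coneC R D) w -> `|z - w| <= r -> f w - phi w <= f z - phi z.
  by move=> dw zw; apply: zmax => //; apply: le_lt_trans rr0.
have a4 : 0 < a / 4 by rewrite divr_gt0.
have [j [Jj [[y [dy zy ymax]] pj]]] := filter_ex (filterI (near_member genJ)
  (filterI (interior_maximizer sphi dz r_gt0 rz zmax') (step_proj_cvg genJ (dphi z).2 a4))).
have := (f_sub Jj).2 _ _ y (@smooth_penalized R D j phi dphi sphi z) dy ymax.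
rewrite /dpenalized /=; set p := (dphi z).2 in ha pj *.
have ly := time_lift_dom dy.
have := hr1 _ ly (lt_trans zy rr1); rewrite prod_norm_le /= => /andP[c1 c2].
have := zy; rewrite prod_norm_lt /= => /andP[d1 d2].
set g := (dphi (time_lift y)).2 in c2 *.
set u := g + _ => sub.
have pu : `|p - u| <= a / 4 + a / 4.
  rewrite /u opprD addrA (le_trans (ler_normB _ _))// lerD//; first by rewrite (le_trans c2).
  by rewrite normrZ ger0_norm// distrC; lra.
have : `|G p - G (step_lift (step_proj j u))| <= e / 3.
  apply: ha; rewrite -ball_normE /=.
  (* Strong convergence is applied to the fixed vector [p]; the remainder [p - u], which depends on
     [j], is controlled by contraction. *)
  have -> : p - step_lift (step_proj j u) =
     (p - step_lift (step_proj j p)) + step_lift (step_proj j (p - u)).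
    by rewrite step_projB step_liftB addrA subrK.
  rewrite (le_lt_trans (ler_normD _ _))// norm_step_lift.
  by have := norm_step_proj j (p - u); lra.
by move: c1 d1 sub; rewrite !ler_norml ltr_norml; lra.
Qed.

End Subsolution.

(** * Exchange of subsolutions and supersolutions *)

Section Duality.
Context (R : realType) (X : innerProductType R).
Implicit Types (dom : set X) (G : X -> R) (f : R * X -> R).

Lemma continuous_dual G : continuous G -> continuous (fun p => - G (- p)).
Proof.
move=> cG p; have := cG (- p); move=> /cvgrPdist_le h; apply/cvgrPdist_le => e e0.
have /nbhs_ballP[a /= a0 ha] := h e e0.
apply/nbhs_ballP; exists a => // x; rewrite -ball_normE /= => px.
rewrite -opprD normrN; apply: ha; rewrite -ball_normE /= -opprD normrN.
exact: px.
Qed.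

Lemma supersolutionN dom G f : viscosity_supersolution dom G f ->
  viscosity_subsolution dom (fun p => - G (- p)) (fun w => - f w).
Proof.
move=> [cf h]; split.
  by apply/subspace_continuousP => z dz; apply: cvgN; exact: ((subspace_continuousP _ _).1 cf).
move=> phi dphi z sphi dz zmax.
have zmin : \forall w \near within (otime_dom dom) (nbhs z), f z - - phi z <= f w - - phi w.
  by apply: filterS zmax => w; lra.
have := h _ _ z (smoothN sphi) dz zmin.
rewrite -[(- dphi z).1]/(- (dphi z).1) -[(- dphi z).2]/(- (dphi z).2); cbv beta; lra.
Qed.

Lemma subsolutionN dom G f :
  viscosity_subsolution dom (fun p => - G (- p)) (fun w => - f w) ->
  viscosity_supersolution dom G f.
Proof.
move=> [cf h]; split.
  apply/subspace_continuousP => z dz; rewrite -[f]opprK; apply: cvgN.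
  exact: ((subspace_continuousP _ _).1 cf).
move=> phi dphi z sphi dz zmin.
have zmax : \forall w \near within (otime_dom dom) (nbhs z), - f w - - phi w <= - f z - - phi z.
  by apply: filterS zmin => w; lra.
have := h _ _ z (smoothN sphi) dz zmax.
rewrite -[(- dphi z).1]/(- (dphi z).1) -[(- dphi z).2]/(- (dphi z).2); cbv beta; rewrite !opprK; lra.
Qed.

End Duality.

Theorem proposition3p9 (R : realType) (D : nat) (H : L2 R D -> R)
    (J : set (partition01 R)) (f_ : forall j : partition01 R, R * stepfun D j -> R)
    (f : R * L2 R D -> R) :
  (0 < D)%N -> continuous H -> generating_partitions J ->
  {family closed_balls (coneC R D), (fun j => pullback (f_ j)) @ net_filter J --> f} ->
  ((forall j, J j ->
      viscosity_subsolution (step_cone D j) (H \o @step_lift R D j) (f_ j)) ->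
    viscosity_subsolution (coneC R D) H f) /\
  ((forall j, J j ->
      viscosity_supersolution (step_cone D j) (H \o @step_lift R D j) (f_ j)) ->
    viscosity_supersolution (coneC R D) H f).
Proof.
move=> _ cH genJ /(family_locally_uniform genJ) f_cvg; split=> hf.
  exact: limit_subsolution f_cvg hf.
apply: subsolutionN.
apply: (@limit_subsolution _ _ _ J (fun j w => - f_ j w) _ _ genJ) => [p|z r e dz e0|j Jj].
- exact: (continuous_dual cH).
- have FF := net_filter_proper genJ; apply: filterS (f_cvg z r e dz e0) => j hj w dw wz.
  by rewrite -opprD normrN; exact: hj.
have := supersolutionN (hf j Jj).
(* Since [step_lift] commutes with negation, dualizing [H] and restricting it to step functions
   commute. *)
by congr (viscosity_subsolution _ _ _); apply/funext => x /=; rewrite step_liftN.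
Qed.
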